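(* Let $M$ be a complete, connected, non-compact Riemannian manifold. Suppose that there exists $C$ such that $$|\nabla_xp_t(x,y)|\le\frac{C}{\sqrt t\,V(y,\sqrt t)},\quad\forall\,t>0,\ x,y\in M.$$ Then there exists $C'>0$ such that $$p_t(x,x)\le\frac{C'}{V(x,\sqrt t)},\quad\forall\,t>0,\ x\in M.$$
   Context: $\mu$ is the Riemannian measure on $M$, $B(x,r)$ the open geodesic ball, $V(x,r)=\mu(B(x,r))$. $\nabla_x$ is the Riemannian gradient in the variable $x$, $\Delta$ the non-negative Laplace-Beltrami operator. $p_t(x,y)$ is the heat kernel, i.e. the positive smooth kernel of $\exp(-t\Delta)$ acting on $L^2(M,\mu)$. *)

(* Defs.v *)
(* Riemannian manifolds, the Laplace-Beltrami operator on L^2 and its heat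
   kernel, on top of MathComp-Analysis.  Conventions: points and tangent vectors
   of R^n are row vectors, so a metric tensor G acts by (v, w) |-> v G w^T and
   [jacobian F x] i k is the i-th partial derivative of the k-th component. *)
From HB Require Import structures.
From mathcomp Require Import all_boot all_order all_algebra.
From mathcomp Require Import all_classical all_reals all_analysis.
Set Implicit Arguments.
Unset Strict Implicit.
Unset Printing Implicit Defensive.
Import Order.TTheory GRing.Theory Num.Theory.
Import numFieldNormedType.Exports.
Local Open Scope classical_set_scope.
Local Open Scope ring_scope.

Notation borel T := (g_sigma_algebraType (@open T)).

(* C^oo on the open set U: every iterated partial derivative is (Frechet)
   differentiable at every point of U. *)
Definition smooth_on (R : realType) (n : nat) (U : set 'rV[R]_n)
    (f : 'rV[R]_n -> R) : Prop :=
  forall (s : seq 'I_n) (x : 'rV[R]_n), U x ->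
    differentiable (foldr (fun i h y => 'D_(delta_mx 0 i) h y) f s) x.

Record chart (R : realType) (n : nat) (M : topologicalType) := Chart {
  cdom : set M;
  cmap : M -> 'rV[R]_n;
  cinv : 'rV[R]_n -> M;
  cdom_open : open cdom;
  cmap_open : open (cmap @` cdom);
  cmap_continuous : {within cdom, continuous cmap};
  cinv_continuous : {within cmap @` cdom, continuous cinv};
  cmapK : forall x, cdom x -> cinv (cmap x) = x }.

Definition ccod (R : realType) n M (c : chart R n M) : set 'rV[R]_n :=
  cmap c @` cdom c.

Definition transition (R : realType) n M (c c' : chart R n M) :
    'rV[R]_n -> 'rV[R]_n :=
  cmap c' \o cinv c.

(* [rmetric i y] is the matrix of the metric tensor in the chart i at the point
   of coordinates y; [chart_at x] is an arbitrary chart around x. *)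
Record riemannian_manifold (R : realType) (n : nat) := RiemannianManifold {
  rpoint :> ptopologicalType;
  rpoint_hausdorff : hausdorff_space rpoint;
  rpoint_second_countable : @second_countable rpoint;
  rindex : Type;
  ratlas : rindex -> chart R n rpoint;
  chart_at : rpoint -> rindex;
  chart_atP : forall x, cdom (ratlas (chart_at x)) x;
  transition_smooth : forall i j k,
    smooth_on (cmap (ratlas i) @` (cdom (ratlas i) `&` cdom (ratlas j)))
      (fun y => transition (ratlas i) (ratlas j) y 0 k);
  rmetric : rindex -> 'rV[R]_n -> 'M[R]_n;
  rmetric_smooth : forall i k l,
    smooth_on (ccod (ratlas i)) (fun y => rmetric i y k l);
  rmetric_sym : forall i y, ccod (ratlas i) y -> (rmetric i y)^T = rmetric i y;
  rmetric_pos : forall i y (v : 'rV[R]_n), ccod (ratlas i) y -> v != 0 ->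
    0 < (v *m rmetric i y *m v^T) 0 0;
  rmetric_transition : forall i j x,
    cdom (ratlas i) x -> cdom (ratlas j) x ->
    let y := cmap (ratlas i) x in
    let J := jacobian (transition (ratlas i) (ratlas j)) y in
    rmetric i y = J *m rmetric j (cmap (ratlas j) x) *m J^T }.

Section Geometry.
Context (R : realType) (n : nat) (M : riemannian_manifold R n).

Definition smooth_fun (f : M -> R) : Prop :=
  forall i, smooth_on (ccod (ratlas i)) (f \o cinv (ratlas i : chart R n M)).

Definition smooth_fun2 (f : M -> M -> R) : Prop :=
  forall i j : rindex M,
    smooth_on
      [set z : 'rV[R]_(n + n) |
        ccod (ratlas i) (lsubmx z) /\ ccod (ratlas j) (rsubmx z)]
      (fun z => f (cinv (ratlas i) (lsubmx z)) (cinv (ratlas j) (rsubmx z))).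

Definition test_fun (f : M -> R) : Prop :=
  smooth_fun f /\
  exists2 K : set M, compact K & forall x, ~ K x -> f x = 0.

(* Tangent vectors at x are given by their coordinates in [chart_at x]; by
   [rmetric_transition], the real numbers [tangent_dot x v w] below do not
   depend on the chart. *)
Definition chart_of (x : M) : chart R n M := ratlas (chart_at x).

Definition metric_at (x : M) : 'M[R]_n :=
  rmetric (chart_at x) (cmap (chart_of x) x).

Definition tangent_dot (x : M) (v w : 'rV[R]_n) : R :=
  (v *m metric_at x *m w^T) 0 0.

Definition tangent_norm (x : M) (v : 'rV[R]_n) : R :=
  Num.sqrt (tangent_dot x v v).

Definition gradient (f : M -> R) (x : M) : 'rV[R]_n :=
  (\row_k 'D_(delta_mx 0 k) (f \o cinv (chart_of x)) (cmap (chart_of x) x))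
    *m invmx (metric_at x).

(* Asking for the derivatives near each t of [0, 1] avoids one-sided
   derivatives at the end points: every C^1 curve on [0, 1] extends a bit. *)
Definition C1_curve (gam : R -> M) : Prop :=
  forall t : R, 0 <= t <= 1 ->
    {for t, continuous gam} /\
    forall i : rindex M, cdom (ratlas i) (gam t) ->
      (\forall s \near t, derivable (cmap (ratlas i) \o gam) s 1) /\
      {for t, continuous (derive1 (cmap (ratlas i) \o gam))}.

Definition curve_length (gam : R -> M) : \bar R :=
  (\int[@lebesgue_measure R]_(t in `[0%R, 1%R])
     (tangent_norm (gam t) (derive1 (cmap (chart_of (gam t)) \o gam) t))%:E)%E.

(* A piecewise C^1 curve is the sequence of its C^1 pieces. *)
Fixpoint joins (x y : M) (s : seq (R -> M)) : Prop :=
  if s is gam :: s' then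
    [/\ C1_curve gam, gam 0 = x & joins (gam 1) y s']
  else x = y.

Definition rdist (x y : M) : \bar R :=
  ereal_inf [set (\sum_(gam <- s) curve_length gam)%E | s in joins x y].

Definition geodesic_ball (x : M) (r : R) : set M :=
  [set y | (rdist x y < r%:E)%E].

Definition complete_manifold : Prop :=
  forall u : nat -> M,
    (forall e : R, 0 < e -> exists N : nat, forall k l : nat,
      (N <= k)%N -> (N <= l)%N -> (rdist (u k) (u l) < e%:E)%E) ->
    exists x : M, u @ \oo --> x.

End Geometry.

Definition is_lebesgue (R : realType) (n : nat)
    (lam : {measure set (borel 'rV[R]_n) -> \bar R}) : Prop :=
  forall a b : 'rV[R]_n, (forall i, a 0 i <= b 0 i) ->
    lam [set x : 'rV[R]_n | forall i, a 0 i < x 0 i <= b 0 i] =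
    (\prod_i (b 0 i - a 0 i))%:E.

(* Lebesgue measure on R^n exists and is the only measure satisfying
   [is_lebesgue]; since M is second countable, the charts then determine mu. *)
Definition is_riemannian_measure (R : realType) (n : nat)
    (M : riemannian_manifold R n) (mu : {measure set (borel M) -> \bar R}) :
    Prop :=
  exists2 lam : {measure set (borel 'rV[R]_n) -> \bar R}, is_lebesgue lam &
    forall (i : rindex M) (A : set (borel M)),
      measurable A -> A `<=` cdom (ratlas i) ->
      mu A = (\int[lam]_(y in (cmap (ratlas i) @` A : set (borel 'rV[R]_n)))
                (Num.sqrt (\det (rmetric i y)))%:E)%E.

Section HeatKernel.
Context (R : realType) (n : nat) (M : riemannian_manifold R n).
Variable mu : {measure set (borel M) -> \bar R}.

Definition volume (x : M) (r : R) : \bar R := mu (geodesic_ball x r).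

Definition L2 (f : M -> R) : Prop := f \in Lfun mu 2%:E.

Definition L2_norm (f : M -> R) : \bar R := ('N[mu]_2%:E [EFin \o f])%E.

Definition dirichlet_form (f h : M -> R) : R :=
  \int[mu]_x tangent_dot x (gradient f x) (gradient h x).

(* Graph of the non-negative Laplace-Beltrami operator Delta on L^2: the
   self-adjoint operator associated with the closure of the form
   (f, h) |-> \int <grad f, grad h> on C^oo_c(M), so that Delta u = v iff u is
   in the form domain and E(u, psi) = <v, psi> for all test functions psi.
   Elements of L^2 are represented by functions. *)
Definition laplace_beltrami (u v : M -> R) : Prop :=
  [/\ L2 u, L2 v &
    exists phi : nat -> M -> R,
      [/\ forall k, test_fun (phi k),
          L2_norm (phi k \- u) @[k --> \oo] --> 0%E,
          forall e : R, 0 < e -> exists N : nat, forall k l : nat,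
            (N <= k)%N -> (N <= l)%N ->
            dirichlet_form (phi k \- phi l) (phi k \- phi l) < e &
          forall psi, test_fun psi ->
            dirichlet_form (phi k) psi @[k --> \oo] -->
            \int[mu]_x (v x * psi x)]].

(* S t = exp(- t Delta): the strongly continuous contraction semigroup on L^2
   whose infinitesimal generator is - Delta. *)
Record is_heat_semigroup (S : R -> (M -> R) -> M -> R) : Prop := {
  heat_L2 : forall t f, 0 <= t -> L2 f -> L2 (S t f);
  heat_linear : forall t (a : R) f h, 0 <= t -> L2 f -> L2 h ->
    {ae mu, forall x, S t (fun y => a * f y + h y) x = a * S t f x + S t h x};
  heat_contraction : forall t f, 0 <= t -> L2 f ->
    (L2_norm (S t f) <= L2_norm f)%E;
  heat_0 : forall f, L2 f -> {ae mu, forall x, S 0 f x = f x};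
  heat_add : forall s t f, 0 <= s -> 0 <= t -> L2 f ->
    {ae mu, forall x, S (s + t) f x = S s (S t f) x};
  heat_continuous : forall f, L2 f ->
    L2_norm (S t f \- f) @[t --> 0^'+] --> 0%E;
  heat_generator : forall u v, L2 u -> L2 v ->
    (laplace_beltrami u v <->
     L2_norm (fun x => t^-1 * (S t u x - u x) + v x) @[t --> 0^'+] --> 0%E) }.

Definition is_heat_kernel (p : R -> M -> M -> R) : Prop :=
  [/\ forall t x y, 0 < t -> 0 < p t x y,
      forall t, 0 < t -> smooth_fun2 (p t) &
      exists2 S, is_heat_semigroup S &
        forall t f, 0 < t -> L2 f ->
          {ae mu, forall x,
             mu.-integrable [set: borel M] (fun y => (p t x y * f y)%:E) /\
             S t f x = \int[mu]_y (p t x y * f y)}].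

End HeatKernel.

(* Main.v *)
Require Import Defs.
From mathcomp Require Import all_boot all_order all_algebra.
From mathcomp Require Import all_classical all_reals all_analysis.
From mathcomp Require Import measurable_realfun.
From mathcomp Require Import ring lra.
Set Implicit Arguments.
Unset Strict Implicit.
Unset Printing Implicit Defensive.
Import Order.TTheory GRing.Theory Num.Theory.
Import numFieldNormedType.Exports.
Local Open Scope classical_set_scope.
Local Open Scope ring_scope.

(** Fix t and x, and put a = p_t(x, x), B = B(x, sqrt t), v = V(x, sqrt t). The
    gradient bound for p_t(., x) has the factor 1 / (sqrt t v), which depends on
    x only; integrated along curves from x of length < sqrt t, it gives
    p_t(z, x) >= a - C / v for z in B ([lipschitz_on_ball]). Either
    a <= 2 C / v and there is nothing to prove, or p_t(., x) >= a / 2 on B and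
      (a / 2)^2 v <= |p_t(., x)|_2^2.
    The square norm on the right is at most a ([heat_kernel_sqr_le]), so that
    a <= 4 / v. If v is infinite, p_t(., x) is constant on B and the same
    inequality is contradictory.

    The bound |p_t(., x)|_2^2 <= p_t(x, x) is an L^2 argument, without any
    appeal to the Markov property. The operators S_t = exp (- t Delta) are
    symmetric contractions, whence
      <S_t g, g> = |S_(t/2) g|^2 >= |S_(t/2) (S_(t/2) g)|^2 = |S_t g|^2,
    and g is taken to be the mean over a coordinate ball that shrinks to x
    ([cball_measure]); Fatou's lemma concludes.

    The symmetry of S_t ([csg_sym]) comes from that of its generator in two
    steps. On the domain, <S_(t-s) u, S_s u'> does not depend on s, because its
    derivative vanishes; this is proved with N steps of length t / N. The domain
    is dense ([generates_dense]), because it contains the means over [0, h] of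
    s |-> S_s f, which are constructed as limits of Riemann sums in the complete
    space L^2 ([L2_complete]).

    The symmetry of Delta ([laplace_beltrami_sym]) is that of the Dirichlet
    form, carried through the approximations by test functions that define
    Delta. This requires the form to be bilinear on test functions, hence the
    pairing of two gradients to be integrable: it is continuous, since it has an
    expression in each chart and these agree ([local_pairing_change]), and
    compact sets have finite measure ([compact_measure_lty]). *)

(** * Symmetry of contraction semigroups *)

Lemma le_of_eq (d : Order.disp_t) (T : porderType d) (x y : T) :
  x = y -> (x <= y)%O.
Proof. by move->. Qed.

(** Discriminant form of the Cauchy-Schwarz inequality, shared by the tangent
    spaces, the L^2 inner product and the Dirichlet form. *)
Lemma quadratic_cauchy_schwarz (R : realType) (A B C : R) :
  0 <= A -> (forall a, 0 <= a ^+ 2 * A + a * B *+ 2 + C) -> B ^+ 2 <= A * C.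
Proof.
rewrite le_eqVlt => /predU1P[<- h|A0 h].
  have [->|B0] := eqVneq B 0; first by rewrite expr2 !mul0r.
  have := h (- (C + 1) / (B *+ 2)); rewrite mulr0 add0r.
  rewrite -mulrnAr mulfVK ?mulrn_eq0//; lra.
have := h (- B / A).
have -> : (- B / A) ^+ 2 * A + - B / A * B *+ 2 + C = (A * C - B ^+ 2) / A.
  by field; rewrite gt_eqF.
by rewrite pmulr_lge0 ?invr_gt0// subr_ge0.
Qed.

Section PreHilbert.
Context (R : realType) (V : lmodType R).

(** Definiteness is left out: the elements of L^2 are functions, not classes of
    almost everywhere equal functions. *)
Record is_semi_inner (ip : V -> V -> R) : Prop := {
  semi_innerC : forall f g, ip f g = ip g f;
  semi_innerP : forall a f h g, ip (a *: f + h) g = a * ip f g + ip h g;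
  semi_inner_ge0 : forall f, 0 <= ip f f }.

Definition semi_norm (ip : V -> V -> R) (f : V) : R := Num.sqrt (ip f f).

Definition semi_norm_complete (ip : V -> V -> R) : Prop :=
  forall u : nat -> V,
    (forall e, 0 < e -> exists N, forall k l, (N <= k)%N -> (N <= l)%N ->
       semi_norm ip (u k - u l) <= e) ->
    exists U, forall e, 0 < e -> exists N, forall k, (N <= k)%N ->
      semi_norm ip (u k - U) <= e.

Variables (ip : V -> V -> R) (ip_inner : is_semi_inner ip).
Let nrm := semi_norm ip.
Let ipC := semi_innerC ip_inner.
Let ipP := semi_innerP ip_inner.

Lemma ipDl f h g : ip (f + h) g = ip f g + ip h g.
Proof. by have := ipP 1 f h g; rewrite scale1r mul1r. Qed.

Lemma ip0l g : ip 0 g = 0.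
Proof. by have := ipDl 0 0 g; rewrite addr0 => h; lra. Qed.

Lemma ipZl a f g : ip (a *: f) g = a * ip f g.
Proof. by have := ipP a f 0 g; rewrite addr0 ip0l addr0. Qed.

Lemma ipNl f g : ip (- f) g = - ip f g.
Proof. by rewrite -scaleN1r ipZl mulN1r. Qed.

Lemma ipBl f h g : ip (f - h) g = ip f g - ip h g.
Proof. by rewrite ipDl ipNl. Qed.

Lemma ip_suml (I : Type) (r : seq I) (F : I -> V) g :
  ip (\sum_(i <- r) F i) g = \sum_(i <- r) ip (F i) g.
Proof.
elim: r => [|i r IH]; first by rewrite !big_nil ip0l.
by rewrite !big_cons ipDl IH.
Qed.

Lemma nrm_ge0 f : 0 <= nrm f. Proof. exact: sqrtr_ge0. Qed.

Lemma sqr_nrm f : nrm f ^+ 2 = ip f f.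
Proof. by rewrite sqr_sqrtr// semi_inner_ge0. Qed.

Lemma ip_le_nrm f g : `|ip f g| <= nrm f * nrm g.
Proof.
rewrite -ler_sqr ?nnegrE ?mulr_ge0 ?nrm_ge0// real_normK ?num_real//.
rewrite exprMn !sqr_nrm; apply: quadratic_cauchy_schwarz.
  exact: semi_inner_ge0.
move=> a; have := semi_inner_ge0 ip_inner (a *: f + g).
rewrite ipDl ipZl [ip f _]ipC [ip g _]ipC !ipDl !ipZl [ip g f]ipC.
by move=> h; lra.
Qed.

(** Duality turns norm estimates into estimates of real numbers: only the
    pairings of [f] are ever computed. *)
Lemma nrm_le_dual f B : 0 <= B -> (forall g, ip f g <= B * nrm g) -> nrm f <= B.
Proof.
move=> B0 h; have := h f; rewrite -sqr_nrm expr2.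
have [->//|f0] := eqVneq (nrm f) 0.
by rewrite ler_pM2r// lt_neqAle eq_sym f0 nrm_ge0.
Qed.

Lemma nrm_le_congr f h : (forall g, ip f g = ip h g) -> nrm f <= nrm h.
Proof.
move=> fh; apply: nrm_le_dual; first exact: nrm_ge0.
by move=> g; rewrite fh (le_trans (ler_norm _))// ip_le_nrm.
Qed.

Lemma nrmN f : nrm (- f) = nrm f.
Proof. by rewrite /nrm /semi_norm ipNl [ip f _]ipC ipNl opprK. Qed.

Lemma nrmB f h : nrm (f - h) = nrm (h - f).
Proof. by rewrite -nrmN opprB. Qed.

Lemma nrmD f h : nrm (f + h) <= nrm f + nrm h.
Proof.
apply: nrm_le_dual => [|g]; first by rewrite addr_ge0 ?nrm_ge0.
by rewrite ipDl mulrDl lerD// (le_trans (ler_norm _)) ?ip_le_nrm.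
Qed.

Lemma nrmZ a f : nrm (a *: f) = `|a| * nrm f.
Proof.
rewrite /nrm /semi_norm ipZl ipC ipZl mulrA -expr2 sqrtrM ?sqr_ge0//.
by rewrite sqrtr_sqr.
Qed.

(** The linearity and semigroup laws hold up to vectors of norm zero, and are
    therefore stated after pairing with an arbitrary vector. *)
Record is_contraction_semigroup (T : R -> V -> V) : Prop := {
  csg_lin : forall t a f h g, 0 <= t ->
    ip (T t (a *: f + h)) g = a * ip (T t f) g + ip (T t h) g;
  csg_le : forall t f, 0 <= t -> nrm (T t f) <= nrm f;
  csg_add : forall s t f g, 0 <= s -> 0 <= t ->
    ip (T (s + t) f) g = ip (T s (T t f)) g;
  csg_cont : forall f e, 0 < e -> exists2 d, 0 < d &
    forall t, 0 <= t -> t <= d -> nrm (T t f - f) <= e }.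

Variables (T : R -> V -> V) (T_csg : is_contraction_semigroup T).

(** The graph of minus the infinitesimal generator. *)
Definition generates (u v : V) : Prop :=
  forall e, 0 < e -> exists2 d, 0 < d &
    forall t, 0 < t -> t <= d -> nrm (T t u - u + t *: v) <= e * t.

Lemma TDl t f h g : 0 <= t -> ip (T t (f + h)) g = ip (T t f) g + ip (T t h) g.
Proof. by move=> t0; have := csg_lin T_csg 1 f h g t0; rewrite scale1r mul1r. Qed.

Lemma T0l t g : 0 <= t -> ip (T t 0) g = 0.
Proof. by move=> t0; have := TDl 0 0 g t0; rewrite addr0 => h; lra. Qed.

Lemma TZl t a f g : 0 <= t -> ip (T t (a *: f)) g = a * ip (T t f) g.
Proof. by move=> t0; have := csg_lin T_csg a f 0 g t0; rewrite addr0 T0l// addr0. Qed.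

Lemma TBl t f h g : 0 <= t -> ip (T t (f - h)) g = ip (T t f) g - ip (T t h) g.
Proof. by move=> t0; rewrite TDl// -scaleN1r TZl// mulN1r. Qed.

Lemma T_suml t (I : Type) (r : seq I) (F : I -> V) g : 0 <= t ->
  ip (T t (\sum_(i <- r) F i)) g = \sum_(i <- r) ip (T t (F i)) g.
Proof.
move=> t0; elim: r => [|i r IH]; first by rewrite !big_nil T0l.
by rewrite !big_cons TDl// IH.
Qed.

Lemma T_at0 f g : ip (T 0 f) g = ip f g.
Proof.
apply/eqP; rewrite -subr_eq0 -ipBl -normr_le0; apply/ler_addgt0Pl => e e0.
rewrite addr0.
have g0 := nrm_ge0 g; have g1 : 0 < nrm g + 1 by lra.
have [d d0 /(_ 0 (lexx _) (ltW d0)) h] := csg_cont T_csg f (divr_gt0 e0 g1).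
apply: le_trans (ip_le_nrm _ _) _.
apply: (@le_trans _ _ (e / (nrm g + 1) * (nrm g + 1))).
  by rewrite ler_pM ?nrm_ge0// lerDl.
by rewrite divfK// gt_eqF.
Qed.

Lemma T_comm s t f g : 0 <= s -> 0 <= t ->
  ip (T s (T t f)) g = ip (T t (T s f)) g.
Proof. by move=> s0 t0; rewrite -!csg_add// addrC. Qed.

Lemma generates_T u v r : 0 <= r -> generates u v -> generates (T r u) (T r v).
Proof.
move=> r0 uv e e0; have [d d0 h] := uv e e0; exists d => // t t0 td.
apply: le_trans (h t t0 td).
apply: le_trans (csg_le T_csg _ r0).
apply: nrm_le_congr => g.
rewrite TDl// TBl// TZl// ipDl ipBl ipZl.
by rewrite T_comm// ltW.
Qed.

Lemma le_steps (a : nat -> R) (c : R) N :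
  (forall k, (k < N)%N -> `|a k - a k.+1| <= c) -> `|a 0%N - a N| <= N%:R * c.
Proof.
elim: N => [|N IH] h; first by rewrite subrr normr0 mul0r.
have -> : a 0%N - a N.+1 = (a 0%N - a N) + (a N - a N.+1) by lra.
rewrite -natr1 mulrDl mul1r (le_trans (ler_normD _ _))// lerD ?h//.
by apply: IH => k kN; apply: h; apply: ltn_trans kN _.
Qed.

Variable generator_sym : forall u v u' v',
  generates u v -> generates u' v' -> ip v u' = ip u v'.

(** Moving time d from one factor to the other costs o(d): to first order the
    two pairings differ from <T r u, T s u'> by - d <T r v, T s u'> and
    - d <T r u, T s v'>, and these agree by symmetry of the generator. *)
Lemma csg_sym_step u v u' v' r s d e : generates u v -> generates u' v' ->
  0 <= r -> 0 <= s -> 0 <= d -> 0 <= e ->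
  nrm (T d u - u + d *: v) <= e * d -> nrm (T d u' - u' + d *: v') <= e * d ->
  `|ip (T (r + d) u) (T s u') - ip (T r u) (T (s + d) u')| <=
    e * d * (nrm u + nrm u').
Proof.
move=> uv uv' r0 s0 d0 e0 h h'.
have sym := generator_sym (generates_T r0 uv) (generates_T s0 uv').
have E1 g : ip (T (r + d) u) g =
    ip (T r (T d u - u + d *: v)) g + ip (T r u) g - d * ip (T r v) g.
  by rewrite csg_add// TDl// TBl// TZl//; lra.
have E2 g : ip (T (s + d) u') g =
    ip (T s (T d u' - u' + d *: v')) g + ip (T s u') g - d * ip (T s v') g.
  by rewrite csg_add// TDl// TBl// TZl//; lra.
rewrite E1 [ip (T r u) (T (s + d) _)]ipC E2.
rewrite [ip (T s u') _]ipC [ip (T s v') _]ipC sym.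
set X := ip (T r _) _; set Y := ip (T s _) _.
have -> : X + ip (T r u) (T s u') - d * ip (T r u) (T s v') -
  (Y + ip (T r u) (T s u') - d * ip (T r u) (T s v')) = X - Y by lra.
rewrite (le_trans (ler_normB _ _))// [nrm u + _]addrC mulrDr lerD//.
  rewrite (le_trans (ip_le_nrm _ _))// ler_pM ?nrm_ge0//.
    exact: le_trans (csg_le T_csg _ r0) _.
  exact: csg_le.
rewrite (le_trans (ip_le_nrm _ _))// ler_pM ?nrm_ge0//.
  exact: le_trans (csg_le T_csg _ s0) _.
exact: csg_le.
Qed.

(** Discrete form of the fact that s |-> <T (t - s) u, T s u'> has zero
    derivative: N steps of length t / N contribute o(1 / N) each. *)
Lemma csg_sym_dom u v u' v' t : generates u v -> generates u' v' -> 0 <= t ->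
  ip (T t u) u' = ip u (T t u').
Proof.
move=> uv uv'; rewrite le_eqVlt => /predU1P[<-|t0].
  by rewrite T_at0 [RHS]ipC T_at0 ipC.
apply/eqP; rewrite -subr_eq0 -normr_le0; apply/ler_addgt0Pl => e e0.
rewrite addr0.
pose c := t * (nrm u + nrm u' + 1).
have c0 : 0 < c by rewrite mulr_gt0//; have := nrm_ge0 u; have := nrm_ge0 u'; lra.
have ec0 : 0 < e / c by rewrite divr_gt0.
have [d d0 h] := uv _ ec0; have [d' d'0 h'] := uv' _ ec0.
pose m := Num.min d d'; have m0 : 0 < m by rewrite lt_min d0.
(* N steps of length t / N <= m, so that both first order expansions apply. *)
pose N := (Num.truncn (t / m)).+1.
have N0 : 0 < N%:R :> R by rewrite ltr0n.
have tN : t / N%:R <= m.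
  by rewrite ler_pdivrMr// mulrC -ler_pdivrMr//; apply/ltW/truncnS_gt.
have tN0 : 0 < t / N%:R by rewrite divr_gt0.
pose a k := ip (T ((N - k)%:R * (t / N%:R)) u) (T (k%:R * (t / N%:R)) u').
have : `|a 0%N - a N| <= N%:R * (e / c * (t / N%:R) * (nrm u + nrm u')).
  apply: le_steps => k kN; rewrite /a.
  have -> : ((N - k)%:R * (t / N%:R) : R) =
      (N - k.+1)%:R * (t / N%:R) + t / N%:R.
    by rewrite subnS -[in LHS](prednK (_ : 0 < N - k)%N) ?subn_gt0// -natr1 mulrDl mul1r.
  have -> : (k.+1%:R * (t / N%:R) : R) = k%:R * (t / N%:R) + t / N%:R.
    by rewrite -natr1 mulrDl mul1r.
  apply: csg_sym_step uv uv' _ _ _ _ _ _; rewrite ?(ltW tN0) ?(ltW ec0)// ?mulr_ge0 ?(ltW t0)//.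
    by apply: h => //; apply: le_trans tN _; rewrite ge_min lexx.
  by apply: h' => //; apply: le_trans tN _; rewrite ge_min lexx orbT.
rewrite /a subn0 subnn !mul0r [N%:R * (t / _)]mulrC divfK ?gt_eqF//.
rewrite [ip (T t u) (T 0 _)]ipC T_at0 [ip u' _]ipC T_at0 => /le_trans; apply.
have -> : N%:R * (e / c * (t / N%:R) * (nrm u + nrm u')) =
    e * (t * (nrm u + nrm u')) / c by field; rewrite !gt_eqF.
rewrite ler_pdivrMr// ler_pM2l// /c ler_pM2l//; lra.
Qed.

(** Riemann sums for the mean of s |-> T s f over [0, h]. *)
Definition riemann_sum (f : V) (h : R) (N : nat) : V :=
  N.+1%:R^-1 *: \sum_(0 <= k < N.+1) T (k%:R * (h / N.+1%:R)) f.

Lemma ip_riemann_sum f h N g : ip (riemann_sum f h N) g =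
  N.+1%:R^-1 * \sum_(0 <= k < N.+1) ip (T (k%:R * (h / N.+1%:R)) f) g.
Proof. by rewrite ipZl ip_suml. Qed.

Lemma sumr_le_const (F : nat -> R) c N :
  (forall k, (k < N)%N -> F k <= c) -> \sum_(0 <= k < N) F k <= N%:R * c.
Proof.
move=> h; rewrite mulrC mulr_natr -[N in leRHS]subn0 -sumr_const_nat.
by apply: ler_sum_nat => k /andP[_ /h].
Qed.

Lemma nrm_mean_le (F : nat -> V) f X c N : 0 <= c ->
  (forall g, ip X g = N.+1%:R^-1 * \sum_(0 <= k < N.+1) ip (F k) g) ->
  (forall k, (k < N.+1)%N -> nrm (F k - f) <= c) -> nrm (X - f) <= c.
Proof.
move=> c0 XE h; apply: nrm_le_dual => // g; rewrite ipBl XE.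
have -> : ip f g = N.+1%:R^-1 * \sum_(0 <= k < N.+1) ip f g.
  by rewrite sumr_const_nat subn0 -[ip f g *+ _]mulr_natl mulKf// pnatr_eq0.
rewrite -mulrBr -sumrB ler_pdivrMl ?ltr0n//.
apply: sumr_le_const => k kN; rewrite -ipBl.
apply: le_trans (ler_norm _) _; apply: le_trans (ip_le_nrm _ _) _.
by rewrite ler_wpM2r ?nrm_ge0// h.
Qed.

Lemma nrm_T_diff a s f : 0 <= a -> 0 <= s ->
  nrm (T (a + s) f - T a f) <= nrm (T s f - f).
Proof.
move=> a0 s0; apply: le_trans (csg_le T_csg _ a0); apply: nrm_le_congr => g.
by rewrite ipBl csg_add// TBl.
Qed.

(** Refining the subdivision changes a Riemann sum by at most the modulus of
    continuity at the coarse mesh. *)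
Lemma riemann_sum_refine f h N M c : 0 < h -> 0 <= c ->
  (forall s, 0 <= s -> s <= h / N.+1%:R -> nrm (T s f - f) <= c) ->
  nrm (riemann_sum f h (N.+1 * M.+1).-1 - riemann_sum f h N) <= c.
Proof.
move=> h0 c0 hc; set K := (N.+1 * M.+1)%N; have K0 : (0 < K)%N by [].
have N0 : N.+1%:R != 0 :> R by rewrite pnatr_eq0.
have M0 : M.+1%:R != 0 :> R by rewrite pnatr_eq0.
apply: nrm_le_dual => // g; rewrite ipBl !ip_riemann_sum prednK//.
have blocks (F : nat -> R) : \sum_(0 <= i < K) F i =
    \sum_(0 <= i < N.+1) \sum_(i * M.+1 <= j < i.+1 * M.+1) F j.
  by rewrite /K big_nat_mul.
rewrite blocks.
rewrite [X in X * _ - _](_ : _ = N.+1%:R^-1 * M.+1%:R^-1); last by rewrite natrM invfM.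
rewrite -mulrA mulr_sumr -mulrBr -sumrB ler_pdivrMl ?ltr0n//.
apply: sumr_le_const => k kN.
rewrite lerBlDr ler_pdivrMl ?ltr0n// -[k.+1]addn1 mulnDl mul1n.
rewrite -{1}[(k * M.+1)%N]add0n big_addn addKn.
apply: sumr_le_const => j jM; rewrite -lerBlDr -ipBl.
have -> : k%:R * (h / N.+1%:R) = (k * M.+1)%:R * (h / K%:R).
  rewrite !natrM; move: (N.+1%:R) (M.+1%:R) N0 M0 => a b a0 b0.
  by field; rewrite a0 b0.
rewrite addnC natrD mulrDl.
have hK : 0 <= h / K%:R by rewrite divr_ge0 ?ltW.
have mulK i : 0 <= i%:R * (h / K%:R) by rewrite mulr_ge0.
apply: le_trans (ler_norm _) _; apply: le_trans (ip_le_nrm _ _) _.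
rewrite ler_wpM2r ?nrm_ge0//.
apply: le_trans (nrm_T_diff _ _ _) _; rewrite ?mulK//.
apply: hc; rewrite ?mulK//.
have -> : h / N.+1%:R = M.+1%:R * (h / K%:R).
  rewrite natrM; move: (N.+1%:R) (M.+1%:R) N0 M0 => a b a0 b0.
  by field; rewrite a0 b0.
by rewrite ler_wpM2r// ler_nat ltnW.
Qed.

(** The increment of a Riemann sum under [T t] is, up to the mesh, the sum of
    the increments of length h of its terms in [0, t). *)
Lemma riemann_sum_increment f h N t c c' : 0 < h -> 0 < t -> 0 <= c -> 0 <= c' ->
  (forall s, 0 <= s -> s <= h / N.+1%:R -> nrm (T s f - f) <= c) ->
  (forall s, 0 <= s -> s <= t -> nrm (T s (T h f - f) - (T h f - f)) <= c') ->
  nrm (T t (riemann_sum f h N) - riemann_sum f h N - (t / h) *: (T h f - f))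
    <= c + N.+1%:R^-1 * nrm (T h f - f) + t / h * c'.
Proof.
move=> h0 t0 c0 c'0 hc hc'; set w := T h f - f; set U := riemann_sum f h N.
have N0 : N.+1%:R != 0 :> R by rewrite pnatr_eq0.
have Np : 0 < N.+1%:R :> R by rewrite ltr0n.
have hn : h != 0 by rewrite gt_eqF.
pose mesh := h / N.+1%:R; have mesh0 : 0 < mesh by rewrite divr_gt0.
pose m := Num.truncn (t / mesh).
have /andP[mt tm] : (m%:R <= t / mesh < m.+1%:R)%R.
  by apply: truncn_itv; rewrite divr_ge0 ?ltW.
rewrite ler_pdivlMr// in mt; rewrite ltr_pdivrMr// -natr1 mulrDl mul1r in tm.
have md0 : 0 <= m%:R * mesh by rewrite mulr_ge0 ?(ltW mesh0).
have TU s g : 0 <= s -> ip (T s U) g =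
    N.+1%:R^-1 * \sum_(0 <= k < N.+1) ip (T (s + k%:R * mesh) f) g.
  move=> s0; rewrite TZl// T_suml//; congr (_ * _); apply: eq_bigr => k _.
  by rewrite csg_add// mulr_ge0 ?(ltW mesh0).
(* Rounding t down to a multiple m of the mesh costs at most c. *)
have step1 : nrm (T t U - T (m%:R * mesh) U) <= c.
  apply: nrm_le_dual => // g; rewrite ipBl (TU _ _ (ltW t0)) (TU _ _ md0) -mulrBr -sumrB.
  rewrite ler_pdivrMl//; apply: sumr_le_const => k kN; rewrite -ipBl.
  apply: le_trans (ler_norm _) _; apply: le_trans (ip_le_nrm _ _) _.
  rewrite ler_wpM2r ?nrm_ge0//.
  have -> : t + k%:R * mesh = m%:R * mesh + k%:R * mesh + (t - m%:R * mesh) by lra.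
  have tm0 : 0 <= t - m%:R * mesh by rewrite subr_ge0.
  have kd : 0 <= k%:R * mesh by rewrite mulr_ge0 ?(ltW mesh0).
  apply: le_trans (nrm_T_diff f (addr_ge0 md0 kd) tm0) _.
  by apply: hc => //; rewrite lerBlDl ltW.
(* The sums over [m, m + N] and [0, N] differ by their ends only. *)
have step2 g : ip (T (m%:R * mesh) U - U) g =
    N.+1%:R^-1 * \sum_(0 <= k < m) ip (T (k%:R * mesh) w) g.
  rewrite ipBl TU// ip_riemann_sum -mulrBr; congr (_ * _).
  pose F k := ip (T (k%:R * mesh) f) g.
  have -> : \sum_(0 <= k < N.+1) ip (T (m%:R * mesh + k%:R * mesh) f) g =
      \sum_(m <= k < m + N.+1) F k.
    rewrite -[X in _ = \sum_(X <= _ < _) _]add0n big_addn addKn; apply: eq_bigr => k _.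
    by rewrite /F addnC natrD mulrDl.
  have -> : \sum_(0 <= k < m) ip (T (k%:R * mesh) w) g =
      \sum_(N.+1 <= k < m + N.+1) F k - \sum_(0 <= k < m) F k.
    rewrite -[X in _ = \sum_(X <= _ < _) _ - _]add0n big_addn addnK -sumrB; apply: eq_bigr => k _.
    have kd : 0 <= k%:R * mesh by rewrite mulr_ge0 ?(ltW mesh0).
    rewrite TBl// -csg_add//; last exact: ltW. rewrite /F natrD mulrDl.
    by have -> : N.+1%:R * mesh = h by rewrite mulrC divfK.
  rewrite -/mesh; apply/eqP; rewrite subr_eq addrAC eq_sym subr_eq; apply/eqP.
  rewrite addrC [RHS]addrC.
  by rewrite -!big_cat_nat ?leq_addr ?leq_addl.
have mth : N.+1%:R^-1 * m%:R <= t / h.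
  by rewrite ler_pdivlMr//; apply: le_trans mt; apply: le_of_eq; rewrite /mesh; ring.
have nw : 0 <= N.+1%:R^-1 * nrm w by rewrite mulr_ge0 ?invr_ge0 ?nrm_ge0.
have tc : 0 <= t / h * c' by rewrite mulr_ge0// divr_ge0 ?(ltW t0) ?(ltW h0).
apply: nrm_le_dual => [|g].
  by rewrite addr_ge0// addr_ge0.
have -> : ip (T t U - U - (t / h) *: w) g = ip (T t U - T (m%:R * mesh) U) g +
    (N.+1%:R^-1 * m%:R - t / h) * ip w g +
    N.+1%:R^-1 * \sum_(0 <= k < m) ip (T (k%:R * mesh) w - w) g.
  under [in RHS]eq_bigr do rewrite ipBl.
  rewrite sumrB sumr_const_nat subn0 mulrBr -step2 !ipBl [ip (_ *: w) _]ipZl !ipBl -[(_ - _) *+ m]mulr_natr.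
  by ring.
rewrite [leRHS]mulrDl [(c + _) * _]mulrDl; apply: lerD; first apply: lerD.
- apply: le_trans (ler_norm _) _; apply: le_trans (ip_le_nrm _ _) _.
  by rewrite ler_wpM2r ?nrm_ge0.
- apply: le_trans (ler_norm _) _; rewrite normrM -mulrA ler_pM//; last exact: ip_le_nrm.
  rewrite ler0_norm ?subr_le0// opprB lerBlDr ler_pdivrMr//.
  apply: le_trans (ltW tm) _.
  by apply: le_of_eq; rewrite /mesh; ring.
rewrite ler_pdivrMl//.
apply: (@le_trans _ _ (m%:R * (c' * nrm g))).
  apply: sumr_le_const => k km.
  apply: le_trans (ler_norm _) _; apply: le_trans (ip_le_nrm _ _) _.
  rewrite ler_wpM2r ?nrm_ge0//; apply: hc'; first by rewrite mulr_ge0 ?(ltW mesh0).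
  by apply: le_trans mt; rewrite ler_wpM2r ?ler_nat 1?ltW// ltnW.
apply: (@le_trans _ _ (N.+1%:R * (t / h) * (c' * nrm g))).
  by rewrite ler_wpM2r ?mulr_ge0 ?nrm_ge0// -ler_pdivrMl.
by apply: le_of_eq; ring.
Qed.

Variable ip_complete : semi_norm_complete ip.

Lemma nrm_triangle f g h : nrm (f - h) <= nrm (f - g) + nrm (g - h).
Proof. by apply: le_trans (nrmD _ _); rewrite addrA subrK. Qed.

(** The mean of s |-> T s f over [0, h] lies in the domain of the generator,
    and tends to f with h. *)
Lemma generates_dense f e : 0 < e ->
  exists u v, generates u v /\ nrm (u - f) <= e.
Proof.
move=> e0; have [h h0 hf] := csg_cont T_csg f e0.
have mesh eps : 0 < eps -> exists N, forall k, (N <= k)%N ->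
    forall s, 0 <= s -> s <= h / k.+1%:R -> nrm (T s f - f) <= eps.
  move=> ep0; have [d d0 hd] := csg_cont T_csg f ep0.
  exists (Num.truncn (h / d)) => k Nk s s0 sk; apply: hd => //.
  apply: le_trans sk _; rewrite ler_pdivrMr// mulrC -ler_pdivrMr//.
  by apply/ltW/(lt_le_trans (truncnS_gt _)); rewrite ler_nat.
have [u0 cvu] : exists U, forall eps, 0 < eps -> exists N, forall k, (N <= k)%N ->
    nrm (riemann_sum f h k - U) <= eps.
  apply: ip_complete => eps ep0.
  have [N HN] := mesh _ (divr_gt0 ep0 (ltr0n R 2)); exists N => k l Nk Nl.
  have := riemann_sum_refine l h0 (ltW (divr_gt0 ep0 (ltr0n R 2))) (HN k Nk).
  have := riemann_sum_refine k h0 (ltW (divr_gt0 ep0 (ltr0n R 2))) (HN l Nl).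
  rewrite mulnC => h1; rewrite nrmB => h2.
  apply: le_trans (nrm_triangle _ _ _) (le_trans (lerD h2 h1) _); lra.
exists u0, (- h^-1 *: (T h f - f)); split; last first.
  apply/ler_addgt0Pl => eps ep0; have [N HN] := cvu _ ep0.
  apply: le_trans (nrm_triangle _ (riemann_sum f h N) _) _.
  rewrite nrmB lerD// ?HN//.
  apply: nrm_mean_le (ip_riemann_sum _ _ _) _; first exact: ltW.
  move=> k kN; apply: hf; first by rewrite mulr_ge0// divr_ge0// ltW.
  by rewrite mulrCA ger_pMr// ler_pdivrMr ?ltr0n// mul1r ler_nat ltnW.
move=> eps ep0; set w := T h f - f.
have [d d0 hd] := csg_cont T_csg w (mulr_gt0 ep0 h0).
exists d => // t t0 td.
have -> : t *: (- h^-1 *: w) = - ((t / h) *: w) by rewrite scalerA mulrN scaleNr.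
have teh : eps * t = t / h * (eps * h) by field; rewrite gt_eqF.
apply/ler_addgt0Pr => r r0; have r4 : 0 < r / 4 by rewrite divr_gt0.
have [N1 HN1] := mesh _ r4; have [N2 HN2] := cvu _ r4.
pose N3 := Num.truncn (nrm w / (r / 4)).
pose N := maxn N1 (maxn N2 N3).
have [n1 [n2 n3]] : (N1 <= N /\ (N2 <= N /\ N3 <= N))%N.
  by rewrite /N !leq_max !leqnn !orbT.
have H := riemann_sum_increment h0 t0 (ltW r4) (ltW (mulr_gt0 ep0 h0)) (HN1 _ n1)
  (fun s s0 st => hd s s0 (le_trans st td)).
have wN : N.+1%:R^-1 * nrm w <= r / 4.
  rewrite ler_pdivrMl ?ltr0n// -ler_pdivrMr//.
  by apply/ltW/(lt_le_trans (truncnS_gt _)); rewrite ler_nat.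
set U := riemann_sum f h N in H *; have HU := HN2 _ n2; rewrite -/U in HU.
have -> : T t u0 - u0 - (t / h) *: w =
    (T t u0 - T t U) + (U - u0) + (T t U - U - (t / h) *: w).
  by rewrite addrA (addrAC (_ - T t U)) !addrA !subrK.
apply: le_trans (nrmD _ _) _; apply: le_trans (lerD (nrmD _ _) H) _.
have : nrm (T t u0 - T t U) <= nrm (U - u0).
  rewrite -[leRHS]nrmB; apply: le_trans (csg_le T_csg _ (ltW t0)).
  by apply: nrm_le_congr => g; rewrite ipBl TBl// ltW.
rewrite teh -/w => hT; move: (_ * nrm w) wN => X wN; lra.
Qed.

(** Vectors of the domain approximate f and g, where symmetry is known, and
    contractivity carries the errors through T t. *)
Lemma csg_sym f g t : 0 <= t -> ip (T t f) g = ip f (T t g).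
Proof.
move=> t0; apply/eqP; rewrite -subr_eq0 -normr_le0; apply/ler_addgt0Pl => e e0.
rewrite addr0.
pose c := nrm f + nrm g + 1.
have f0 := nrm_ge0 f; have g0 := nrm_ge0 g.
have c0 : 0 < c by rewrite /c; lra.
(* Four error terms, each at most e1 * c. *)
pose e1 := Num.min 1 (e / (4 * c)).
have e10 : 0 < e1 by rewrite lt_min ltr01 divr_gt0// mulr_gt0.
have e11 : e1 <= 1 by rewrite ge_min lexx.
have e1c : e1 * (4 * c) <= e.
  by rewrite -ler_pdivlMr ?mulr_gt0// ge_min lexx orbT.
have [u [v [uv uf]]] := generates_dense f e10.
have [u' [v' [uv' ug]]] := generates_dense g e10.
have S := csg_sym_dom uv uv' t0.
have -> : ip (T t f) g - ip f (T t g) =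
    ip (T t (f - u)) g + ip (T t u) (g - u') + ip (u - f) (T t u') +
    ip f (T t (u' - g)).
  rewrite TBl// ![ip _ (_ - _)]ipC [ip f (T _ (_ - _))]ipC TBl// !ipBl.
  rewrite [ip g _]ipC [ip u' (T t u)]ipC S [ip (T t u') f]ipC [ip (T t g) f]ipC.
  lra.
have nu : nrm u <= nrm f + e1.
  by have := nrmD (u - f) f; rewrite subrK; lra.
have nu' : nrm u' <= nrm g + e1.
  by have := nrmD (u' - g) g; rewrite subrK; lra.
have Tle x := csg_le T_csg x t0.
have b1 : `|ip (T t (f - u)) g| <= e1 * nrm g.
  apply: le_trans (ip_le_nrm _ _) _; rewrite ler_wpM2r ?nrm_ge0//.
  by apply: le_trans (Tle _) _; rewrite nrmB.
have b2 : `|ip (T t u) (g - u')| <= (nrm f + e1) * e1.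
  apply: le_trans (ip_le_nrm _ _) _; rewrite ler_pM ?nrm_ge0//.
    exact: le_trans (Tle _) _.
  by rewrite nrmB.
have b3 : `|ip (u - f) (T t u')| <= e1 * (nrm g + e1).
  apply: le_trans (ip_le_nrm _ _) _; rewrite ler_pM ?nrm_ge0//.
  exact: le_trans (Tle _) _.
have b4 : `|ip f (T t (u' - g))| <= nrm f * e1.
  apply: le_trans (ip_le_nrm _ _) _; rewrite ler_wpM2l ?nrm_ge0//.
  exact: le_trans (Tle _) _.
apply: le_trans (ler_normD _ _) _; apply: le_trans (lerD _ b4) _.
  apply: le_trans (ler_normD _ _) _; apply: lerD b3.
  by apply: le_trans (ler_normD _ _) _; apply: lerD b1 b2.
apply: le_trans e1c; rewrite /c.
have e11' : e1 * e1 <= e1 by rewrite ger_pMr.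
have := mulr_ge0 (ltW e10) f0; have := mulr_ge0 (ltW e10) g0.
rewrite -/nrm => q1 q2; lra.
Qed.

(** Half of the time is spent on each side: <T t f, f> = |T (t/2) f|^2. *)
Lemma csg_nrm_le f t : 0 <= t -> nrm (T t f) ^+ 2 <= ip (T t f) f.
Proof.
move=> t0; have t2 : 0 <= t / 2 by rewrite divr_ge0.
have E g : ip (T t f) g = ip (T (t / 2) (T (t / 2) f)) g.
  by rewrite -csg_add//; congr (ip (T _ _) _); lra.
rewrite E csg_sym// -sqr_nrm ler_sqr ?nnegrE ?nrm_ge0//.
exact: le_trans (nrm_le_congr E) (csg_le T_csg _ t2).
Qed.

End PreHilbert.

(** * The Hilbert space L^2 *)

Section L2.
Context d (T : measurableType d) (R : realType).
Variable mu : {measure set T -> \bar R}.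

Lemma ge0_fatou_le (f : nat -> T -> R) (g : T -> R) (c : \bar R) :
  (forall n, measurable_fun setT (f n)) -> (forall n x, 0 <= f n x) ->
  measurable_fun setT g -> (forall x, 0 <= g x) ->
  {ae mu, forall x, f n x @[n --> \oo] --> g x} ->
  (forall n, (\int[mu]_x (f n x)%:E <= c)%E) -> (\int[mu]_x (g x)%:E <= c)%E.
Proof.
move=> mf f0 mg g0 fg fc.
have mF n : measurable_fun setT (fun x => (f n x)%:E) by exact/measurable_EFinP.
have F0 n x : setT x -> (0 <= (f n x)%:E)%E by rewrite lee_fin f0.
apply: (@le_trans _ _ (limn_einf (fun n => \int[mu]_x (f n x)%:E))%E); last first.
  rewrite limn_einf_lim; apply: lime_le; first exact: is_cvg_einfs.
  apply: nearW => n; apply: le_trans (fc n).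
  by apply: ereal_inf_lbound; exists n => /=.
apply: le_trans (fatou mu measurableT mF F0).
apply: ae_ge0_le_integral => //.
- by move=> x _; rewrite lee_fin.
- exact/measurable_EFinP.
- move=> x _; rewrite limn_einf_lim; apply: lime_ge; first exact: is_cvg_einfs.
  by apply: nearW => n; apply: le_ereal_inf_tmp => _ [m _ <-]; rewrite lee_fin.
- under eq_fun do rewrite limn_einf_lim.
  apply: emeasurable_fun_cvg => [|x _]; last exact: is_cvg_einfs.
  exact: measurable_fun_einfs.
- apply: filterS fg => x fgx _.
  have /cvg_limn_einf_sup[-> _] // : (f n x)%:E @[n --> \oo] --> (g x)%:E.
  exact: cvg_comp fgx _.
Qed.

Variable p1 : (1 <= 2%:E :> \bar R)%E.
Local Notation V := (LfunType mu p1).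

Lemma measurable_L2 (f : V) : measurable_fun setT f.
Proof. exact: measurable_funPT. Qed.
Local Hint Resolve measurable_L2 : core.

Lemma measurable_sqr_sub (f g : T -> R) : measurable_fun setT f ->
  measurable_fun setT g -> measurable_fun setT (fun x => (f x - g x) ^+ 2).
Proof. by move=> mf mg; apply: measurable_funX; apply: measurable_funB. Qed.

Definition L2_inner (f g : V) : R := \int[mu]_x (f x * g x).

Lemma L2_integrableM (f g : V) :
  mu.-integrable setT (EFin \o (fun x => f x * g x)).
Proof. by apply/Lfun1_integrable/Lfun2_mul_Lfun1; exact: LfunP. Qed.

Lemma L2_inner_is_semi_inner : is_semi_inner L2_inner.
Proof.
split=> [f g|a f h g|f].
- by apply: eq_Rintegral => x _; rewrite mulrC.
- rewrite /L2_inner -RintegralZl//; last exact: L2_integrableM.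
  rewrite -RintegralD//; last 2 first.
  + have := @integrableZl _ _ _ mu _ measurableT a _ (L2_integrableM f g).
    by apply: eq_integrable => // x _; rewrite /= EFinM.
  + exact: L2_integrableM.
  by apply: eq_Rintegral => x _; rewrite mulrDl mulrA.
- by apply: Rintegral_ge0 => x _; rewrite -expr2 sqr_ge0.
Qed.

Lemma L2_innerE (f : V) : (L2_inner f f)%:E = (\int[mu]_x (f x ^+ 2)%:E)%E.
Proof.
rewrite fineK; last exact: integrable_fin_num (L2_integrableM f f).
by apply: eq_integral => x _; rewrite expr2.
Qed.

Lemma L2_normE (f : V) :
  'N[mu]_2%:E[EFin \o f]%E = (semi_norm L2_inner f)%:E.
Proof.
rewrite unlock /=.
under eq_integral do rewrite /= powR_mulrn// real_normK ?num_real//.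
rewrite -L2_innerE poweR_EFin powR12_sqrt//.
exact: semi_inner_ge0 L2_inner_is_semi_inner _.
Qed.

Lemma sqr_integral_L2 (f : T -> R) : measurable_fun setT f ->
  (\int[mu]_x (f x ^+ 2)%:E < +oo)%E -> f \in Lfun mu 2%:E.
Proof.
move=> mf foo; rewrite inE; apply/andP; split; rewrite inE//=.
rewrite /finite_norm unlock /= poweR_lty//.
by under eq_integral do rewrite /= powR_mulrn// real_normK ?num_real//.
Qed.

(** The weights 4^j still leave a convergent integral, so almost everywhere
    the increments are O(2^-j), hence summable. *)
Lemma fast_cauchy_cvg (v : nat -> V) :
  (forall j, semi_norm L2_inner (v j.+1 - v j) <= (4 ^+ j.+1)^-1) ->
  {ae mu, forall x, cvgn (v ^~ x)}.
Proof.
move=> hv.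
pose dv j x : R := 4 ^+ j * (v j.+1 x - v j x) ^+ 2.
have dv0 j x : 0 <= dv j x by rewrite mulr_ge0 ?sqr_ge0 ?exprn_ge0.
have dvE0 j x : (0 <= (dv j x)%:E)%E by rewrite lee_fin.
have mdv j : measurable_fun setT (fun x => (dv j x)%:E).
  apply/measurable_EFinP; apply: measurable_funM => //.
  exact: measurable_sqr_sub.
have idv j : (\int[mu]_x (dv j x)%:E <= (1 / (2 ^ (j + 1))%:R)%:E)%E.
  under eq_integral do rewrite EFinM.
  rewrite ge0_integralZl_EFin ?exprn_ge0//; last 2 first.
  - by move=> x _; rewrite lee_fin sqr_ge0.
  - by apply/measurable_EFinP; exact: measurable_sqr_sub.
  have -> : (\int[mu]_x ((v j.+1 x - v j x) ^+ 2)%:E)%E =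
      (L2_inner (v j.+1 - v j) (v j.+1 - v j))%:E by rewrite L2_innerE.
  rewrite -(sqr_nrm L2_inner_is_semi_inner) -EFinM lee_fin.
  apply: (@le_trans _ _ (4 ^+ j * ((4 ^+ j.+1)^-1) ^+ 2)).
    have n0 : 0 <= semi_norm L2_inner (v j.+1 - v j) by exact: nrm_ge0.
    have i0 : (0 : R) <= (4 ^+ j.+1)^-1 by rewrite invr_ge0 exprn_ge0.
    by rewrite ler_wpM2l ?exprn_ge0// ler_sqr ?hv.
  have -> : 4 ^+ j * ((4 ^+ j.+1)^-1) ^+ 2 = 4^-1 * (4 ^+ j.+1)^-1 :> R.
    have p4 : (4 : R) ^+ j != 0 by rewrite expf_neq0.
    by rewrite [4 ^+ j.+1]exprS; field.
  have : (4 ^+ j.+1 : R)^-1 <= (2 ^+ j.+1)^-1.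
    rewrite lef_pV2 ?posrE ?exprn_gt0//.
    by rewrite lerXn2r ?nnegrE//; lra.
  have : (0 : R) <= (4 ^+ j.+1)^-1 by rewrite invr_ge0 exprn_ge0.
  rewrite addn1 natrX div1r; lra.
pose G x : \bar R := (\sum_(0 <= j <oo) (dv j x)%:E)%E.
have iG : mu.-integrable setT G.
  have mG : measurable_fun setT G.
    apply: (@ge0_emeasurable_sum _ _ _ setT (fun j x => (dv j x)%:E) xpredT).
      by move=> *; exact: dvE0.
    by move=> *; exact: mdv.
  apply/integrableP; split => //.
  under eq_integral do rewrite gee0_abs ?nneseries_ge0//.
  rewrite integral_nneseries//.
  apply: (@le_lt_trans _ _ (\sum_(0 <= j <oo) (1 / (2 ^ (j + 1))%:R)%:E)%E).
    by apply: lee_nneseries => // j _ _; rewrite integral_ge0.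
  have /cvg_lim -> // := @cvg_geometric_eseries_half R 1 0.
  exact: ltry.
apply: filterS (integrable_ae measurableT iG) => x /(_ I) Gx.
have bd j : `|v j.+1 x - v j x| <= Num.sqrt (fine (G x)) * 2^-1 ^+ j.
  have : dv j x <= fine (G x).
    rewrite -lee_fin fineK//.
    apply: le_trans (nneseries_lim_ge j.+1 _) => //.
    by rewrite big_nat_recr//= leeDr// sume_ge0.
  have p4 : (0 : R) < 2 ^+ j by rewrite exprn_gt0.
  rewrite exprVn ler_pdivlMr// => h.
  rewrite -[X in _ * X]gtr0_norm// -normrM -sqrtr_sqr ler_wsqrtr//.
  apply: le_trans _ h; apply: le_of_eq; rewrite /dv exprMn mulrC; congr (_ * _).
  by rewrite -exprM mulnC exprM expr2; congr (_ ^+ j); lra.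
apply/cvg_ex.
have : cvgn (series (telescope (v ^~ x))).
  apply: normed_cvg => /=.
  apply: (@series_le_cvg _ _ (geometric (Num.sqrt (fine (G x))) 2^-1)) => //.
  - by move=> n; exact: normr_ge0.
  - by move=> n; rewrite /geometric /= mulr_ge0 ?sqrtr_ge0// exprn_ge0// invr_ge0.
  - apply: is_cvg_geometric_series; rewrite ger0_norm; lra.
move=> /cvg_ex[l hl]; exists (v 0%N x + l).
have -> : v ^~ x = (fun n => v 0%N x + series (telescope (v ^~ x)) n).
  by apply/funext => n; rewrite -eq_sum_telescope.
by apply: cvgD => //; exact: cvg_cst.
Qed.

(** Riesz-Fischer: a subsequence of a Cauchy sequence converges almost
    everywhere, and Fatou's lemma makes its pointwise limit a limit in L^2. *)
Lemma L2_complete : semi_norm_complete L2_inner.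
Proof.
move=> u cu.
have /choice[n0 hn0] : forall j : nat, exists N, forall k l, (N <= k)%N ->
    (N <= l)%N -> semi_norm L2_inner (u k - u l) <= (4 ^+ j.+1)^-1.
  by move=> j; apply: cu; rewrite invr_gt0 exprn_gt0.
(* A strictly increasing choice of ranks beyond the moduli n0 j. *)
pose ph := fix ph j := if j is i.+1 then maxn (ph i).+1 (n0 i.+1) else n0 0%N.
have phn j : (n0 j <= ph j)%N by case: j => //= i; rewrite leq_maxr.
have phS j : (ph j <= ph j.+1)%N by apply: leq_trans (leqnSn _) _; rewrite /= leq_maxl.
have phid j : (j <= ph j)%N.
  by elim: j => //= j IH; rewrite leq_max ltnS IH.
pose v j := u (ph j).
have /fast_cauchy_cvg cvx : forall j,
    semi_norm L2_inner (v j.+1 - v j) <= (4 ^+ j.+1)^-1.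
  by move=> j; apply: hn0 => //; apply: leq_trans (phS _).
have [A [mA A0 hA]] := cvx.
(* Cutting off a null set makes the convergence hold everywhere. *)
pose w j x : R := v j x * \1_(~` A) x.
pose U x : R := limn (w ^~ x).
have wU x : w ^~ x @ \oo --> U x.
  have [Ax|Ax] := pselect (A x).
    have w0 j : w j x = 0 by rewrite /w indicE memNset ?mulr0//; exact.
    rewrite /U; have -> : w ^~ x = cst 0 by apply/funext.
    by rewrite lim_cst//; exact: cvg_cst.
  have wv j : w j x = v j x by rewrite /w indicE mem_set ?mulr1.
  rewrite /U; have -> : w ^~ x = v ^~ x by apply/funext.
  by apply: contrapT => h; apply: Ax; apply: hA.
have mU : measurable_fun setT U.
  apply: (@measurable_fun_cvg _ _ _ setT w) => [j|x _]; last exact: wU.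
  apply: measurable_funM => //; apply: measurable_indic; exact: measurableC.
have aeU : {ae mu, forall x, v ^~ x @ \oo --> U x}.
  exists A; split => // x /= hx; apply: contrapT => Ax; apply: hx.
  have wv j : w j x = v j x by rewrite /w indicE mem_set ?mulr1.
  by have := wU x; have -> : w ^~ x = v ^~ x by apply/funext.
have key e : 0 < e -> exists N, forall k, (N <= k)%N ->
    (\int[mu]_x ((u k x - U x) ^+ 2)%:E <= (e ^+ 2)%:E)%E.
  move=> e0; have [N hN] := cu e e0; exists N => k Nk.
  apply: (@ge0_fatou_le (fun i x => (u k x - u (ph (i + N)) x) ^+ 2)).
  - by move=> i; apply: measurable_funX; apply: measurable_funB.
  - by move=> i x; rewrite sqr_ge0.
  - exact: measurable_sqr_sub.
  - by move=> x; rewrite sqr_ge0.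
  - apply: filterS aeU => x vx.
    have vx' : (v (i + N)%N x) @[i --> \oo] --> U x by have := vx; rewrite -(cvg_shiftn N).
    by apply: cvgM; apply: cvgB => //; exact: cvg_cst.
  - move=> i.
    have -> : (\int[mu]_x ((u k x - u (ph (i + N)) x) ^+ 2)%:E)%E =
      (L2_inner (u k - u (ph (i + N))) (u k - u (ph (i + N))))%:E by rewrite L2_innerE.
    rewrite -(sqr_nrm L2_inner_is_semi_inner) lee_fin ler_sqr ?nnegrE ?(ltW e0)//.
      apply: hN => //; apply: leq_trans (phid _); exact: leq_addl.
    exact: nrm_ge0.
have [N0 hN0] := key 1 ltr01.
have UL2 : U \in Lfun mu 2%:E.
  have D : (fun x => u N0 x - U x) \in Lfun mu 2%:E.
    apply: sqr_integral_L2; first exact: measurable_funB.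
    by apply: le_lt_trans (hN0 _ (leqnn _)) _; rewrite ltry.
  have -> : U = (u N0 : T -> R) - (fun x => u N0 x - U x).
    by apply/funext => x; rewrite !fctE /= opprB addrC subrK.
  by apply: rpredB => //; exact: LfunP.
exists (Lfun_Sub p1 UL2) => e e0; have [N hN] := key e e0; exists N => k Nk.
rewrite -ler_sqr ?nnegrE ?(ltW e0)//; last exact: nrm_ge0.
by rewrite (sqr_nrm L2_inner_is_semi_inner) -lee_fin L2_innerE; exact: hN.
Qed.

End L2.

(** * Matrix valued maps *)

Section MatrixCalculus.
Context (R : realType).

Lemma cvg_sumr (T : Type) (F : set_system T) (FF : Filter F) (I : Type)
    (r : seq I) (P : pred I) (f : I -> T -> R) (l : I -> R) :
  (forall i, f i x @[x --> F] --> l i) ->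
  (\sum_(i <- r | P i) f i x) @[x --> F] --> \sum_(i <- r | P i) l i.
Proof.
move=> h; elim: r => [|i r IH].
  rewrite big_nil; under eq_fun do rewrite big_nil; exact: cvg_cst.
rewrite big_cons; under eq_fun do rewrite big_cons.
by case: (P i) => //; apply: cvgD.
Qed.

Lemma cvg_prodr (T : Type) (F : set_system T) (FF : Filter F) (I : Type)
    (r : seq I) (P : pred I) (f : I -> T -> R) (l : I -> R) :
  (forall i, f i x @[x --> F] --> l i) ->
  (\prod_(i <- r | P i) f i x) @[x --> F] --> \prod_(i <- r | P i) l i.
Proof.
move=> h; elim: r => [|i r IH].
  rewrite big_nil; under eq_fun do rewrite big_nil; exact: cvg_cst.
rewrite big_cons; under eq_fun do rewrite big_cons.
by case: (P i) => //; apply: cvgM.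
Qed.

(** Entrywise convergence, the form in which the product, the determinant and
    the inverse are seen to be continuous. *)
Definition mx_cvg (T : Type) (F : set_system T) m n (f : T -> 'M[R]_(m, n))
    (A : 'M[R]_(m, n)) :=
  forall i j, f x i j @[x --> F] --> A i j.

Section MxCvg.
Context (T : Type) (F : set_system T) {FF : Filter F}.

Lemma mx_cvg_mul m n p (f : T -> 'M[R]_(m, n)) (g : T -> 'M[R]_(n, p)) A B :
  mx_cvg F f A -> mx_cvg F g B -> mx_cvg F (fun x => f x *m g x) (A *m B).
Proof.
move=> fA gB i j; rewrite mxE; under eq_fun do rewrite mxE.
by apply: cvg_sumr => k; apply: cvgM; [exact: fA|exact: gB].
Qed.

Lemma mx_cvg_tr m n (f : T -> 'M[R]_(m, n)) A :
  mx_cvg F f A -> mx_cvg F (fun x => (f x)^T) A^T.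
Proof. by move=> fA i j; rewrite mxE; under eq_fun do rewrite mxE; exact: fA. Qed.

Lemma cvg_det n (f : T -> 'M[R]_n) A :
  mx_cvg F f A -> \det (f x) @[x --> F] --> \det A.
Proof.
move=> fA; apply: cvg_sumr => s; apply: cvgM; first exact: cvg_cst.
by apply: cvg_prodr => i; exact: fA.
Qed.

Lemma mx_cvg_inv n (f : T -> 'M[R]_n) A : A \in unitmx ->
  mx_cvg F f A -> (\forall x \near F, f x \in unitmx) ->
  mx_cvg F (fun x => invmx (f x)) (invmx A).
Proof.
move=> uA fA uf i j.
have d0 : \det A != 0 by move: uA; rewrite unitmxE unitfE.
have h : (\det (f x))^-1 * \adj (f x) i j @[x --> F] --> (\det A)^-1 * \adj A i j.
  apply: cvgM; first by apply: cvgV => //; exact: cvg_det.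
  rewrite !mxE; under eq_fun do rewrite !mxE.
  apply: cvgM; first exact: cvg_cst.
  by apply: cvg_det => k l; rewrite !mxE; under eq_fun do rewrite !mxE; exact: fA.
rewrite /invmx uA mxE; apply: cvg_trans h; apply: near_eq_cvg.
near=> x; have ux : f x \in unitmx by near: x.
by rewrite /= ux [RHS]mxE.
Unshelve. all: by end_near. Qed.

End MxCvg.

Lemma differentiable_rV (V : normedModType R) n (f : V -> 'rV[R]_n) x :
  (forall k, differentiable (fun y => f y 0 k) x) -> differentiable f x.
Proof.
move=> h.
have -> : f = \sum_(k < n) (fun y => f y 0 k *: (delta_mx 0 k : 'rV[R]_n)).
  by apply/funext => y; rewrite fct_sumE; exact: row_sum_delta.
by apply: differentiable_sum => k; apply: differentiableZl.
Qed.

(** The row of partial derivatives. *)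
Definition partials n (h : 'rV[R]_n -> R) (y : 'rV[R]_n) : 'rV[R]_n :=
  \row_k 'D_(delta_mx 0 k) h y.

Lemma derive_partials n (h : 'rV[R]_n -> R) y v : differentiable h y ->
  'D_v h y = (v *m (partials h y)^T) 0 0.
Proof.
move=> dh; rewrite deriveE// [in LHS](row_sum_delta v) linear_sum mxE.
by apply: eq_bigr => k _; rewrite linearZ /= -deriveE// !mxE.
Qed.

Lemma cvg_rV (T : Type) (F : set_system T) (FF : Filter F) n
    (f : T -> 'rV[R]_n) (l : 'rV[R]_n) :
  (forall k, f x 0 k @[x --> F] --> l 0 k) -> f x @[x --> F] --> l.
Proof.
move=> h; apply/cvgrPdist_le => e e0; near=> x.
rewrite /Num.Def.normr/= mx_normrE (bigmax_le _ (ltW e0))//= => -[i k] _ /=.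
rewrite !mxE ord1; move: k; near: x; apply: filter_forall => k.
exact: ((cvgrPdist_le _ _).1 (h k)).
Unshelve. all: by end_near. Qed.

End MatrixCalculus.

(** * Calculus in charts *)

Section ChartCalculus.
Context (R : realType) (n : nat) (M : riemannian_manifold R n).
Local Notation atl i := (ratlas i : chart R n M).
Implicit Types (i j : rindex M) (x : M) (y : 'rV[R]_n) (f h : M -> R).

Lemma ccodP i y : ccod (atl i) y ->
  cdom (atl i) (cinv (atl i) y) /\ cmap (atl i) (cinv (atl i) y) = y.
Proof. by move=> [x dx <-]; rewrite cmapK. Qed.

Lemma cmap_ccod i x : cdom (atl i) x -> ccod (atl i) (cmap (atl i) x).
Proof. by move=> dx; exists x. Qed.

Lemma cmap_cvg i x : cdom (atl i) x -> {for x, continuous (cmap (atl i))}.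
Proof.
move=> dx; have := @cmap_continuous _ _ _ (atl i).
by rewrite continuous_open_subspace; [apply; rewrite inE|exact: cdom_open].
Qed.

Lemma cinv_cvg i y : ccod (atl i) y -> {for y, continuous (cinv (atl i))}.
Proof.
move=> dy; have := @cinv_continuous _ _ _ (atl i).
by rewrite continuous_open_subspace; [apply; rewrite inE|exact: cmap_open].
Qed.

Lemma near_ccod i y : ccod (atl i) y -> \forall z \near y, ccod (atl i) z.
Proof. by move=> dy; apply: open_nbhs_nbhs; split => //; exact: cmap_open. Qed.

Lemma near_cdom i x : cdom (atl i) x -> \forall z \near x, cdom (atl i) z.
Proof. by move=> dx; apply: open_nbhs_nbhs; split => //; exact: cdom_open. Qed.

Lemma cmap_img_open i (A : set M) : open A -> A `<=` cdom (atl i) ->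
  open (cmap (atl i) @` A).
Proof.
move=> oA Ad; rewrite openE => y [x Ax <-].
have cy := cmap_ccod (Ad _ Ax).
have : \forall z \near cmap (atl i) x, A (cinv (atl i) z).
  apply: (cinv_cvg cy); rewrite cmapK; last exact: Ad.
  exact: open_nbhs_nbhs.
move=> Az; near=> z.
exists (cinv (atl i) z); first by near: z.
by apply: (ccodP _).2; near: z; exact: near_ccod.
Unshelve. all: by end_near. Qed.

Lemma transition_differentiable i j x : cdom (atl i) x -> cdom (atl j) x ->
  differentiable (transition (atl i) (atl j)) (cmap (atl i) x).
Proof.
move=> dix djx; apply: differentiable_rV => k.
by apply: (@transition_smooth _ _ M i j k [::]); exists x.
Qed.

Lemma near_transition i j x : cdom (atl i) x -> cdom (atl j) x ->
  \forall z \near cmap (atl i) x,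
    [/\ ccod (atl i) z, cdom (atl j) (cinv (atl i) z) &
        cinv (atl j) (transition (atl i) (atl j) z) = cinv (atl i) z].
Proof.
move=> dix djx.
have oD : open (cdom (atl i) `&` cdom (atl j)) by apply: openI; exact: cdom_open.
have : nbhs (cmap (atl i) x) (cmap (atl i) @` (cdom (atl i) `&` cdom (atl j))).
  apply: open_nbhs_nbhs; split; last by exists x.
  by apply: cmap_img_open oD _ => z [].
apply: filterS => _ [z [diz djz] <-].
by rewrite /transition /= !cmapK//; split => //; exact: cmap_ccod.
Qed.

Definition local_partials i f x : 'rV[R]_n :=
  partials (f \o cinv (atl i)) (cmap (atl i) x).

Definition metric_in i x : 'M[R]_n := rmetric i (cmap (atl i) x).

Definition C1_fun f : Prop := forall i y, ccod (atl i) y ->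
  differentiable (f \o cinv (atl i)) y /\
  forall k, {for y, continuous ('D_(delta_mx 0 k) (f \o cinv (atl i)))}.

Lemma smooth_C1 f : smooth_fun f -> C1_fun f.
Proof.
move=> sf i y dy; split; first exact: (sf i [::]).
by move=> k; apply: differentiable_continuous; exact: (sf i [:: k]).
Qed.

Lemma C1_continuous f : C1_fun f -> continuous f.
Proof.
move=> cf x; set i := chart_at x; have dx := chart_atP x.
have [df _] := cf i _ (cmap_ccod dx).
have : f (cinv (atl i) (cmap (atl i) z)) @[z --> x] --> f x.
  rewrite -{2}(cmapK dx).
  apply: (@continuous_comp _ _ _ (cmap (atl i)) (f \o cinv (atl i)) x).
    exact: cmap_cvg.
  exact: differentiable_continuous.
apply: cvg_trans; apply: near_eq_cvg.
by near=> z; rewrite /= cmapK//; near: z; exact: near_cdom.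
Unshelve. all: by end_near. Qed.

Definition jac i j x := jacobian (transition (atl i) (atl j)) (cmap (atl i) x).

(** Chain rule for a change of charts. *)
Lemma local_partials_change i j f x : C1_fun f ->
  cdom (atl i) x -> cdom (atl j) x ->
  local_partials i f x = local_partials j f x *m (jac i j x)^T.
Proof.
move=> cf dix djx; have dT := transition_differentiable dix djx.
have [dfj _] := cf j _ (cmap_ccod djx).
have Tx : transition (atl i) (atl j) (cmap (atl i) x) = cmap (atl j) x.
  by rewrite /transition /= cmapK.
apply/rowP => k; rewrite !mxE.
have -> : 'D_(delta_mx 0 k) (f \o cinv (atl i)) (cmap (atl i) x) =
    'D_(delta_mx 0 k) ((f \o cinv (atl j)) \o transition (atl i) (atl j))
       (cmap (atl i) x).
  by apply: near_eq_derive; apply: filterS (near_transition dix djx) => z [_ _ /= ->].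
rewrite deriveE; last by apply: differentiable_comp => //; rewrite Tx.
rewrite diff_comp ?Tx// /= -!deriveE// deriveEjacobian// -rowE derive_partials//.
by rewrite mxE; apply: eq_bigr => l _; rewrite !mxE mulrC.
Qed.

Lemma metric_change i j x : cdom (atl i) x -> cdom (atl j) x ->
  metric_in i x = jac i j x *m metric_in j x *m (jac i j x)^T.
Proof. exact: rmetric_transition. Qed.

Lemma metric_sym i x : cdom (atl i) x -> (metric_in i x)^T = metric_in i x.
Proof. by move=> dx; apply: rmetric_sym; exact: cmap_ccod. Qed.

Lemma rmetric_unit i y : ccod (atl i) y -> rmetric i y \in unitmx.
Proof.
move=> dy; rewrite unitmxE unitfE; apply/negP => /det0P[v v0 vG].
by have := rmetric_pos dy v0; rewrite vG mul0mx mxE ltxx.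
Qed.

(** A factor of the invertible matrix [metric_in i x]. *)
Lemma jac_unit i j x : cdom (atl i) x -> cdom (atl j) x -> jac i j x \in unitmx.
Proof.
move=> dix djx; have := rmetric_unit (cmap_ccod dix).
by rewrite -/(metric_in i x) (metric_change dix djx) !unitmx_mul -andbA => /andP[].
Qed.

(** The pairing of two gradients in a fixed chart. Since [chart_at] is an
    arbitrary choice of charts, continuity in x can only be read off from such
    an expression. *)
Definition local_pairing i f h x : R :=
  (local_partials i f x *m invmx (metric_in i x) *m (local_partials i h x)^T) 0 0.

(** The jacobian cancels between the two gradients and the inverse metric. *)
Lemma local_pairing_change i j f h x : C1_fun f -> C1_fun h ->
  cdom (atl i) x -> cdom (atl j) x ->
  local_pairing i f h x = local_pairing j f h x.
Proof.
move=> cf ch dix djx; rewrite /local_pairing.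
rewrite (local_partials_change cf dix djx) (local_partials_change ch dix djx).
have uJ := jac_unit dix djx.
have uG : metric_in j x \in unitmx by exact/rmetric_unit/cmap_ccod.
have uG' : metric_in i x \in unitmx by exact/rmetric_unit/cmap_ccod.
rewrite trmx_mul trmxK !mulmxA.
suff -> : invmx (metric_in j x) = (jac i j x)^T *m invmx (metric_in i x) *m jac i j x.
  by rewrite !mulmxA.
apply: (can_inj (mulKmx uG)); rewrite mulmxV//.
apply: (can_inj (mulKmx uJ)); rewrite mulmx1 !mulmxA.
by rewrite -(metric_change dix djx) mulmxV// mul1mx.
Qed.

Definition grad_pairing f h x : R := tangent_dot x (gradient f x) (gradient h x).

Lemma grad_pairingE i f h x : C1_fun f -> C1_fun h -> cdom (atl i) x ->
  grad_pairing f h x = local_pairing i f h x.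
Proof.
move=> cf ch dx; have dx' := chart_atP x.
rewrite (local_pairing_change cf ch dx dx') /grad_pairing /tangent_dot.
rewrite /gradient -/(local_partials (chart_at x) f x) -/(local_partials (chart_at x) h x).
rewrite -/(metric_in (chart_at x) x) /local_pairing.
have uG : metric_in (chart_at x) x \in unitmx by exact/rmetric_unit/cmap_ccod.
by rewrite mulmxKV// trmx_mul trmx_inv metric_sym// mulmxA.
Qed.

Lemma metric_cvg i y : ccod (atl i) y -> mx_cvg (nbhs y) (rmetric i) (rmetric i y).
Proof.
move=> dy k l; apply: differentiable_continuous.
exact: (rmetric_smooth k l [::] dy).
Qed.

Lemma grad_pairing_continuous f h : C1_fun f -> C1_fun h ->
  continuous (grad_pairing f h).
Proof.
move=> cf ch x; set i := chart_at x; have dx := chart_atP x.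
have cy := cmap_ccod dx.
have Px g : C1_fun g ->
    mx_cvg (nbhs x) (local_partials i g) (local_partials i g x).
  move=> cg k l; rewrite ord1 !mxE; under eq_fun do rewrite !mxE.
  exact: (@cvg_comp _ _ _ (cmap (atl i)) ('D_(delta_mx 0 l) (g \o cinv (atl i)))
    (nbhs x) (nbhs (cmap (atl i) x)) _ (cmap_cvg dx) ((cg i _ cy).2 l)).
have Gx : mx_cvg (nbhs x) (metric_in i) (metric_in i x).
  move=> k l; exact: (@cvg_comp _ _ _ (cmap (atl i)) (fun y => rmetric i y k l)
    (nbhs x) (nbhs (cmap (atl i) x)) _ (cmap_cvg dx) (@metric_cvg i _ cy k l)).
have : local_pairing i f h z @[z --> x] --> local_pairing i f h x.
  apply: mx_cvg_mul; last by apply: mx_cvg_tr; exact: Px.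
  apply: mx_cvg_mul; first exact: Px.
  apply: mx_cvg_inv => //; first exact: rmetric_unit.
  near=> z; apply: rmetric_unit; apply: cmap_ccod; near: z; exact: near_cdom.
rewrite /continuous_at (grad_pairingE cf ch dx); apply: cvg_trans.
apply: near_eq_cvg; near=> z; rewrite (@grad_pairingE i)//.
by near: z; exact: near_cdom.
Unshelve. all: by end_near. Qed.

Lemma tangent_dot_ge0 x v : 0 <= tangent_dot x v v.
Proof.
have [->|v0] := eqVneq v 0; first by rewrite /tangent_dot !mul0mx mxE.
by apply/ltW/rmetric_pos => //; exact/cmap_ccod/chart_atP.
Qed.

Lemma tangent_dotC x v w : tangent_dot x v w = tangent_dot x w v.
Proof.
have trE (A : 'M[R]_1) : A 0 0 = A^T 0 0 by rewrite mxE.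
rewrite /tangent_dot trE !trmx_mul trmxK mulmxA.
by rewrite [(metric_at x)^T](metric_sym (chart_atP x)).
Qed.

Lemma tangent_dot_lin x a v v' w :
  tangent_dot x (a *: v + v') w = a * tangent_dot x v w + tangent_dot x v' w.
Proof. by rewrite /tangent_dot !mulmxDl -!scalemxAl !mxE. Qed.

Lemma tangent_dot_quadratic x v w a :
  tangent_dot x (a *: v + w) (a *: v + w) =
  a ^+ 2 * tangent_dot x v v + a * tangent_dot x v w *+ 2 + tangent_dot x w w.
Proof.
rewrite tangent_dot_lin ![tangent_dot x _ (_ + _)]tangent_dotC !tangent_dot_lin.
rewrite [tangent_dot x w v]tangent_dotC; ring.
Qed.

Lemma tangent_cauchy_schwarz x v w :
  `|tangent_dot x v w| <= tangent_norm x v * tangent_norm x w.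
Proof.
rewrite -ler_sqr ?nnegrE ?mulr_ge0 ?sqrtr_ge0// real_normK ?num_real//.
rewrite exprMn !sqr_sqrtr ?tangent_dot_ge0//.
apply: quadratic_cauchy_schwarz; first exact: tangent_dot_ge0.
by move=> a; rewrite -tangent_dot_quadratic tangent_dot_ge0.
Qed.

End ChartCalculus.

(** * Curves and the geodesic distance *)

Section Curves.
Context (R : realType) (n : nat) (M : riemannian_manifold R n).
Local Notation atl i := (ratlas i : chart R n M).
Local Notation lebR := (@lebesgue_measure R).
Implicit Types (i j : rindex M) (x y : M) (f h : M -> R) (gam : R -> M).

Definition velocity i gam (t : R) : 'rV[R]_n := derive1 (cmap (atl i) \o gam) t.

Definition speed gam (t : R) : R :=
  tangent_norm (gam t) (velocity (chart_at (gam t)) gam t).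

Lemma C1_velocity i gam t : C1_curve gam -> 0 <= t <= 1 -> cdom (atl i) (gam t) ->
  \forall s \near t, cdom (atl i) (gam s) /\ derivable (cmap (atl i) \o gam) s 1.
Proof.
move=> cg t01 dt; have [ct /(_ i dt)[dg _]] := cg t t01.
by apply: filterS2 dg => [s Hs ds|]; [split|exact: (ct _ (near_cdom dt))].
Qed.

Lemma velocity_change i j gam t : C1_curve gam -> 0 <= t <= 1 ->
  cdom (atl i) (gam t) -> cdom (atl j) (gam t) ->
  velocity j gam t = velocity i gam t *m jac i j (gam t).
Proof.
move=> cg t01 dit djt.
have near_i := C1_velocity cg t01 dit; have near_j := C1_velocity cg t01 djt.
have [_ di] := nbhs_singleton near_i.
have dT := transition_differentiable dit djt.
have diffi : differentiable (cmap (atl i) \o gam) t by exact/derivable1_diffP.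
rewrite /velocity derive1E.
have -> : 'D_1 (cmap (atl j) \o gam) t =
    'D_1 (transition (atl i) (atl j) \o (cmap (atl i) \o gam)) t.
  apply: near_eq_derive; apply: filterS near_i => s [ds _].
  by rewrite /transition /= cmapK.
rewrite deriveE; last exact: differentiable_comp.
rewrite diff_comp// /= -[X in 'd _ _ X]/('d (cmap (atl i) \o gam) t 1).
by rewrite -(derive1E' diffi) /jac /jacobian mul_rV_lin1.
Qed.

Lemma speed_in_chart i gam t : C1_curve gam -> 0 <= t <= 1 -> cdom (atl i) (gam t) ->
  speed gam t = Num.sqrt
    ((velocity i gam t *m metric_in i (gam t) *m (velocity i gam t)^T) 0 0).
Proof.
move=> cg t01 dit; have djt := chart_atP (gam t).
rewrite /speed /tangent_norm /tangent_dot (velocity_change cg t01 dit djt).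
by rewrite (metric_change dit djt) trmx_mul !mulmxA.
Qed.

Lemma velocity_cvg i gam t : C1_curve gam -> 0 <= t <= 1 -> cdom (atl i) (gam t) ->
  mx_cvg (nbhs t) (velocity i gam) (velocity i gam t).
Proof.
move=> cg t01 dt; have [_ /(_ i dt)[_ cv]] := cg t t01 => k l.
exact: (@cvg_comp _ _ _ (velocity i gam) (fun v : 'rV[R]_n => v k l) _
  (nbhs (velocity i gam t)) _ cv (@coord_continuous R 1 n k l _)).
Qed.

Lemma speed_continuous gam : C1_curve gam -> {within `[0, 1], continuous (speed gam)}.
Proof.
move=> cg; apply/subspace_continuousP => t /=; rewrite in_itv/= => t01.
set i := chart_at (gam t); have dt : cdom (atl i) (gam t) := chart_atP _.
have [ct _] := cg t t01.
have Gt : mx_cvg (nbhs t) (fun s => metric_in i (gam s)) (metric_in i (gam t)).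
  move=> k l; exact: (@cvg_comp _ _ _ (cmap (atl i) \o gam)
    (fun y : 'rV[R]_n => rmetric i y k l) (nbhs t) (nbhs (cmap (atl i) (gam t))) _
    (continuous_comp ct (cmap_cvg dt)) (@metric_cvg _ _ _ i _ (cmap_ccod dt) k l)).
have Vt := velocity_cvg cg t01 dt.
have : Num.sqrt ((velocity i gam s *m metric_in i (gam s) *m (velocity i gam s)^T) 0 0)
    @[s --> t] --> speed gam t.
  rewrite (speed_in_chart cg t01 dt); apply: continuous_cvg; first exact: sqrt_continuous.
  by apply: mx_cvg_mul; [exact: mx_cvg_mul|exact: mx_cvg_tr].
move=> /(@cvg_within_filter _ _ _ _ _ _ `[0%R, 1%R]) h; apply: cvg_trans h.
apply: near_eq_cvg; rewrite near_withinE; near=> s => /=; rewrite in_itv/= => s01.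
apply/esym; apply: speed_in_chart => //; near: s; exact: (ct _ (near_cdom dt)).
Unshelve. all: by end_near. Qed.

Lemma C1_comp_near f gam t i : C1_fun f -> C1_curve gam -> 0 <= t <= 1 ->
  cdom (atl i) (gam t) ->
  \forall s \near t, derivable (f \o gam) s 1 /\
    derive1 (f \o gam) s = (velocity i gam s *m (local_partials i f (gam s))^T) 0 0.
Proof.
move=> cf cg t01 dt; have := C1_velocity cg t01 dt.
move/near_join; apply: filterS => s near_s.
have [ds dcs] := nbhs_singleton near_s.
have diffi : differentiable (cmap (atl i) \o gam) s by exact/derivable1_diffP.
have [df _] := cf i _ (cmap_ccod ds).
have fE : {near s, (f \o cinv (atl i)) \o (cmap (atl i) \o gam) =1 f \o gam}.
  by apply: filterS near_s => r [dr _]; rewrite /= cmapK.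
have dd : differentiable ((f \o cinv (atl i)) \o (cmap (atl i) \o gam)) s.
  exact: differentiable_comp.
split; first by apply: near_eq_derivable fE _; exact: diff_derivable.
rewrite derive1E -(near_eq_derive _ fE) deriveE// diff_comp//=.
by rewrite -[X in 'd _ _ X](derive1E' diffi) -deriveE// derive_partials.
Qed.

Lemma C1_comp_continuous f gam t : C1_fun f -> C1_curve gam -> 0 <= t <= 1 ->
  {for t, continuous (derive1 (f \o gam))}.
Proof.
move=> cf cg t01; set i := chart_at (gam t).
have dt : cdom (atl i) (gam t) := chart_atP _.
have [ct _] := cg t t01.
have nE := C1_comp_near cf cg t01 dt.
have : (velocity i gam s *m (local_partials i f (gam s))^T) 0 0 @[s --> t] -->
    derive1 (f \o gam) t.
  rewrite (nbhs_singleton nE).2; apply: mx_cvg_mul; first exact: velocity_cvg.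
  apply: mx_cvg_tr => k l; rewrite ord1 !mxE; under eq_fun do rewrite !mxE.
  exact: (@cvg_comp _ _ _ (cmap (atl i) \o gam)
    ('D_(delta_mx 0 l) (f \o cinv (atl i))) (nbhs t)
    (nbhs (cmap (atl i) (gam t))) _
    (continuous_comp ct (cmap_cvg dt)) ((cf i _ (cmap_ccod dt)).2 l)).
apply: cvg_trans; apply: near_eq_cvg; apply: filterS nE.
by move=> s [_ ->].
Qed.

(** In coordinates, the derivative of f along gam is the pairing of the
    velocity with the gradient. *)
Lemma C1_comp_le f gam t (L : R) : C1_fun f -> C1_curve gam -> 0 <= t <= 1 ->
  (forall x, tangent_norm x (gradient f x) <= L) ->
  `|derive1 (f \o gam) t| <= L * speed gam t.
Proof.
move=> cf cg t01 hL; have dt := chart_atP (gam t).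
rewrite (nbhs_singleton (C1_comp_near cf cg t01 dt)).2.
have uG := rmetric_unit (cmap_ccod dt).
have -> : (velocity (chart_at (gam t)) gam t *m
      (local_partials (chart_at (gam t)) f (gam t))^T) 0 0 =
    tangent_dot (gam t) (velocity (chart_at (gam t)) gam t) (gradient f (gam t)).
  rewrite /tangent_dot /gradient trmx_mul trmx_inv.
  by rewrite [(metric_at _)^T](metric_sym dt) mulmxA mulmxK.
apply: le_trans (tangent_cauchy_schwarz _ _ _) _.
by rewrite mulrC ler_wpM2r ?sqrtr_ge0.
Qed.

Lemma curve_length_ge0 gam : (0 <= curve_length gam)%E.
Proof. by apply: integral_ge0 => t _; rewrite lee_fin sqrtr_ge0. Qed.

(** Fundamental theorem of calculus along the curve. *)
Lemma lipschitz_along_curve f gam (L : R) : C1_fun f -> C1_curve gam ->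
  (forall x, tangent_norm x (gradient f x) <= L) ->
  (`|f (gam 1) - f (gam 0)|%:E <= L%:E * curve_length gam)%E.
Proof.
move=> cf cg hL.
have L0 : 0 <= L by apply: le_trans (hL (gam 0)); exact: sqrtr_ge0.
have itv01 (t : R) : t \in `[0%R, 1%R] -> 0 <= t <= 1 by rewrite in_itv.
have m01 : measurable (`[0%R, 1%R] : set R) by [].
have cF : {within `[0, 1], continuous (derive1 (f \o gam))}.
  apply/subspace_continuousP => t /itv01 t01.
  apply: cvg_within_filter; exact: (C1_comp_continuous cf cg t01).
have dF t : 0 <= t <= 1 -> derivable (f \o gam) t 1.
  by move=> t01; have [] := nbhs_singleton (C1_comp_near cf cg t01 (chart_atP _)).
have ctF t : 0 <= t <= 1 -> {for t, continuous (f \o gam)}.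
  move=> /dF h; apply: differentiable_continuous; exact/derivable1_diffP.
have FTC : (\int[lebR]_(t in `[0%R, 1%R]) (derive1 (f \o gam) t)%:E =
    (f (gam 1))%:E - (f (gam 0))%:E)%E.
  apply: (@continuous_FTC2 _ _ (f \o gam)) => //.
  split.
  - by move=> t; rewrite in_itv/= => /andP[t0 t1]; apply: dF; rewrite !ltW.
  - by apply: cvg_at_right_filter; apply: ctF; rewrite lexx ler01.
  - by apply: cvg_at_left_filter; apply: ctF; rewrite lexx ler01.
have mF : measurable_fun (`[0%R, 1%R] : set R) (derive1 (f \o gam)).
  exact: subspace_continuous_measurable_fun.
have mS : measurable_fun (`[0%R, 1%R] : set R) (speed gam).
  by apply: subspace_continuous_measurable_fun => //; exact: speed_continuous.
rewrite -abse_EFin EFinB -FTC.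
apply: le_trans (le_abse_integral _ _ _) _ => //; first exact/measurable_EFinP.
rewrite /curve_length -ge0_integralZl_EFin//; last 2 first.
- by move=> t _; rewrite lee_fin sqrtr_ge0.
- exact/measurable_EFinP.
apply: ge0_le_integral => //.
- by apply/measurable_EFinP; exact: measurableT_comp.
- by apply/measurable_EFinP; exact: measurable_funM.
- by move=> t /itv01 t01; rewrite lee_fin C1_comp_le.
Qed.

Lemma lipschitz_along_joins f (L : R) x y (s : seq (R -> M)) : C1_fun f ->
  (forall x, tangent_norm x (gradient f x) <= L) -> joins x y s ->
  (`|f y - f x|%:E <= L%:E * \sum_(gam <- s) curve_length gam)%E.
Proof.
move=> cf hL; elim: s x => [|gam s IH] x /=.
  by move=> ->; rewrite subrr normr0 big_nil mule0.
move=> [cg <- /IH js]; rewrite big_cons ge0_muleDr ?curve_length_ge0//; last first.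
  by apply: sume_ge0 => *; exact: curve_length_ge0.
apply: (@le_trans _ _ (`|f (gam 1) - f (gam 0)| + `|f y - f (gam 1)|)%:E).
  have -> : f y - f (gam 0) = (f (gam 1) - f (gam 0)) + (f y - f (gam 1)) by lra.
  by rewrite lee_fin ler_normD.
by rewrite EFinD leeD// lipschitz_along_curve.
Qed.

Lemma lipschitz_on_ball f (L r : R) x z : C1_fun f -> 
  (forall x, tangent_norm x (gradient f x) <= L) -> geodesic_ball x r z ->
  `|f z - f x| <= L * r.
Proof.
move=> cf hL; rewrite /geodesic_ball /= /rdist.
move=> /ereal_inf_lt[_ [s js <-] sr].
have L0 : 0 <= L by apply: le_trans (hL x); exact: sqrtr_ge0.
rewrite -lee_fin EFinM; apply: le_trans (lipschitz_along_joins cf hL js) _.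
by rewrite lee_wpmul2l ?lee_fin// ltW.
Qed.

End Curves.

(** * Geodesic balls are open *)

Lemma derive_line (R : realType) (V W : normedModType R) (F : V -> W) (y v : V)
    (s : R) : 'D_1 (fun r : R => F (y + r *: v)) s = 'D_v F (y + s *: v).
Proof.
rewrite /derive; set g := (fun h => _); set g' := (X in _ = lim (fmap X _)).
suff -> : g = g' by []. apply/funext => h; rewrite /g /g' /=.
by rewrite [h%:A](mulr1) scalerDl addrCA.
Qed.

Lemma derivable_line (R : realType) (V W : normedModType R) (F : V -> W)
    (y v : V) (s : R) :
  derivable F (y + s *: v) v -> derivable (fun r : R => F (y + r *: v)) s 1.
Proof.
rewrite /derivable; set g := (X in cvg (fmap X _) -> _); set g' := (X in _ -> cvg (fmap X _)).
suff -> : g = g' by []. apply/funext => q; rewrite /g /g' /=.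
by rewrite [q%:A](mulr1) scalerDl addrCA.
Qed.

Lemma line_cvg (R : realType) (V : normedModType R) (y v : V) (t : R) :
  {for t, continuous (fun s : R => y + s *: v)}.
Proof. by apply: cvgD; [exact: cvg_cst|apply: cvgZr_tmp; exact: cvg_id]. Qed.

Section GeodesicBalls.
Context (R : realType) (n : nat) (M : riemannian_manifold R n).
Local Notation atl i := (ratlas i : chart R n M).
Local Notation lebR := (@lebesgue_measure R).
Implicit Types (i j : rindex M) (x : M) (y v : 'rV[R]_n) (gam : R -> M).

Definition segment i y v (t : R) : M := cinv (atl i) (y + t *: v).

(** In any other chart the segment is the image of an affine line under a
    smooth change of charts. *)
Lemma segment_C1 i y v :
  (forall t : R, 0 <= t <= 1 -> ccod (atl i) (y + t *: v)) -> C1_curve (segment i y v).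
Proof.
move=> hseg t /hseg ct; have [dit cK] := ccodP ct; split.
  apply: (@continuous_comp _ _ _ (fun s : R => y + s *: v) (cinv (atl i))).
    exact: line_cvg.
  exact: cinv_cvg.
move=> j djt; pose T := transition (atl i) (atl j).
have near_y : \forall z \near (y + t *: v), ccod (atl i) z /\ cdom (atl j) (cinv (atl i) z).
  have := near_transition dit djt; rewrite cK.
  by apply: filterS => z [].
have dTz z : ccod (atl i) z -> cdom (atl j) (cinv (atl i) z) -> differentiable T z.
  by move=> /ccodP[dz zK] djz; rewrite -zK; exact: transition_differentiable.
have near_t : \forall s \near t, differentiable T (y + s *: v).
  have : \forall s \near t, ccod (atl i) (y + s *: v) /\
      cdom (atl j) (cinv (atl i) (y + s *: v)) by exact: (@line_cvg _ _ y v t _ near_y).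
  by apply: filterS => s [? ?]; exact: dTz.
split.
  apply: filterS near_t => s dT.
  by apply: (@derivable_line _ _ _ T); exact: diff_derivable.
have vE : \forall s \near t, derive1 (cmap (atl j) \o segment i y v) s = 'D_v T (y + s *: v).
  by near=> s; rewrite derive1E; exact: (derive_line T).
have h : 'D_v T (y + s *: v) @[s --> t] --> 'D_v T (y + t *: v).
  apply: (@cvg_comp _ _ _ (fun s : R => y + s *: v) ('D_v T) (nbhs t)
    (nbhs (y + t *: v)) _ (@line_cvg _ _ y v t)).
  apply: cvg_rV => k.
  have comp_k z : differentiable T z ->
      'D_v T z 0 k = (v *m (partials (fun y => T y 0 k) z)^T) 0 0.
    move=> dT; rewrite derive_mx; last exact: diff_derivable.
    rewrite mxE derive_partials//.
    exact: (@differentiable_comp _ _ _ _ T (fun N : 'rV[R]_n => N 0 k) z dT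
      (differentiable_coord _ _ _)).
  have dTt := dTz _ ct djt; rewrite (comp_k _ dTt).
  have : (v *m (partials (fun y => T y 0 k) z)^T) 0 0 @[z --> y + t *: v] -->
      (v *m (partials (fun y => T y 0 k) (y + t *: v))^T) 0 0.
    apply: (@mx_cvg_mul _ _ (nbhs (y + t *: v)) _ _ _ _ (fun=> v)).
      by move=> a b; exact: cvg_cst.
    apply: mx_cvg_tr => a b; rewrite ord1 !mxE; under eq_fun do rewrite !mxE.
    apply: (@differentiable_continuous R _ _ (y + t *: v) ('D_(delta_mx 0 b) (fun y => T y 0 k))).
    by apply: (@transition_smooth _ _ M i j k [:: b]); exists (cinv (atl i) (y + t *: v)).
  apply: cvg_trans; apply: near_eq_cvg; apply: filterS near_y => z [cz dz].
  by rewrite comp_k//; exact: dTz.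
have := nbhs_singleton vE; move: h => /[swap] <-.
apply: cvg_trans; apply: near_eq_cvg; apply: filterS vE => s ->.
by [].
Unshelve. all: by end_near. Qed.

Lemma segment_speed i y v t :
  (forall t : R, 0 <= t <= 1 -> ccod (atl i) (y + t *: v)) -> 0 <= t <= 1 ->
  speed (segment i y v) t = Num.sqrt ((v *m rmetric i (y + t *: v) *m v^T) 0 0).
Proof.
move=> hseg t01; have cg := segment_C1 hseg; have ct := hseg t t01.
have [dit cK] := ccodP ct.
have vE : velocity i (segment i y v) t = v.
  rewrite /velocity derive1E -[RHS](derive_id (y + t *: v)) -(derive_line id).
  have hs : \forall s \near t, ccod (atl i) (y + s *: v).
    exact: (@line_cvg _ _ y v t _ (near_ccod ct)).
  apply: near_eq_derive; apply: filterS hs => s cs; rewrite /segment /=; exact: (ccodP cs).2.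
by rewrite (speed_in_chart cg t01 dit) vE /metric_in /segment cK.
Qed.

Lemma metric_bounded i y : ccod (atl i) y -> exists2 K : R, 0 < K &
  \forall z \near y, forall v,
    Num.sqrt ((v *m rmetric i z *m v^T) 0 0) <= K * `|v|.
Proof.
move=> cy; pose B := \sum_k \sum_l (`|rmetric i y k l| + 1).
have B0 : 0 <= B by do 2 (apply: sumr_ge0 => ? _); rewrite addr_ge0.
exists (Num.sqrt B + 1); first by rewrite ltr_wpDl ?sqrtr_ge0.
have nG : \forall z \near y, forall kl : 'I_n * 'I_n,
    `|rmetric i z kl.1 kl.2| <= `|rmetric i y kl.1 kl.2| + 1.
  suff h kl : \forall z \near y,
      `|rmetric i z kl.1 kl.2| <= `|rmetric i y kl.1 kl.2| + 1.
    exact: (@filter_forall 'rV[R]_n ('I_n * 'I_n)%type (fun kl z =>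
      `|rmetric i z kl.1 kl.2| <= `|rmetric i y kl.1 kl.2| + 1) (nbhs y) _ h).
  case: kl => k l /=; have := @metric_cvg _ _ _ i y cy k l.
  move/cvgrPdist_le => /(_ 1 ltr01); apply: filterS => z hz.
  have -> : rmetric i z k l = rmetric i y k l - (rmetric i y k l - rmetric i z k l).
    by lra.
  by rewrite (le_trans (ler_normB _ _))// lerD2l.
apply: filterS nG => z hz v.
have vk k : `|v 0 k| <= `|v|.
  by rewrite [leRHS]/Num.Def.normr/= mx_normrE; exact: (le_bigmax _ _ (0, k)).
have hB : (v *m rmetric i z *m v^T) 0 0 <= B * `|v| ^+ 2.
  rewrite mxE /B exchange_big mulr_suml; apply: ler_sum => l _ /=.
  rewrite !mxE !mulr_suml; apply: ler_sum => k _.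
  apply: le_trans (ler_norm _) _; rewrite !normrM mulrAC mulrC.
  by rewrite ler_pM ?mulr_ge0// ?(hz (k, l))// expr2 ler_pM.
apply: le_trans (ler_wsqrtr hB) _.
rewrite sqrtrM// sqrtr_sqr normr_id ler_wpM2r//.
by rewrite lerDl.
Qed.

Lemma joins_rcons x0 x1 x2 (s : seq (R -> M)) gam : joins x0 x1 s ->
  C1_curve gam -> gam 0 = x1 -> gam 1 = x2 -> joins x0 x2 (rcons s gam).
Proof.
elim: s x0 => [|g s IH] x0 /=; first by move=> -> cg g0 g1; split.
by move=> [cg <- js] *; split => //; exact: IH.
Qed.

Lemma curve_length_le gam (c : R) : C1_curve gam ->
  (forall t, 0 <= t <= 1 -> speed gam t <= c) -> (curve_length gam <= c%:E)%E.
Proof.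
move=> cg hc; have c0 : 0 <= c.
  by apply: le_trans (hc 0 _); rewrite ?lexx ?ler01//; exact: sqrtr_ge0.
have m01 : measurable (`[0%R, 1%R] : set R) by [].
have -> : c%:E = (\int[lebR]_(t in `[0%R, 1%R]) (cst c%:E) t)%E.
  by rewrite integral_cst//= lebesgue_measure_itv/= lte01 oppr0 adde0 mule1.
apply: ge0_le_integral => //.
- by move=> t _; rewrite lee_fin sqrtr_ge0.
- apply/measurable_EFinP; apply: subspace_continuous_measurable_fun => //.
  exact: speed_continuous.
Qed.

(** Around each point, straight segments in a chart show that the geodesic
    distance is bounded by a multiple of the coordinate distance, so a curve of
    length < r can be prolonged a bit in every direction. *)
Lemma geodesic_ball_open x r : open (@geodesic_ball R n M x r).
Proof.
rewrite openE => x1 /= /ereal_inf_lt[_ [s js <-] sr].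
set i := chart_at x1; have d1 : cdom (atl i) x1 := chart_atP _.
have c1 := cmap_ccod d1; set y := cmap (atl i) x1 in c1.
have [K K0 hK] := metric_bounded c1.
have /nbhs_ballP[d /= d0 hd] : \forall z \near y, ccod (atl i) z /\
    forall v, Num.sqrt ((v *m rmetric i z *m v^T) 0 0) <= K * `|v|.
  by apply: filterS2 hK (near_ccod c1) => z; split.
have len0 : (0 <= \sum_(gam <- s) curve_length gam)%E.
  by apply: sume_ge0 => *; exact: curve_length_ge0.
have lfin : (\sum_(gam <- s) curve_length gam)%E \is a fin_num.
  by rewrite ge0_fin_numE// (lt_trans sr) ?ltry.
set l := fine (\sum_(gam <- s) curve_length gam)%E.
have lr : l < r by rewrite -lte_fin fineK.
have e0 : 0 < Num.min d ((r - l) / K) by rewrite lt_min d0 divr_gt0// subr_gt0.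
have : \forall z \near x1, ball y (Num.min d ((r - l) / K)) (cmap (atl i) z).
  by apply: (cmap_cvg d1); exact: nbhsx_ballx.
move=> hz; near=> z; rewrite /geodesic_ball /=.
have dz : cdom (atl i) z by near: z; exact: near_cdom.
have : ball y (Num.min d ((r - l) / K)) (cmap (atl i) z) by near: z.
rewrite -ball_normE /= lt_min => /andP[vd vr].
pose v := cmap (atl i) z - y.
have vn : `|y - cmap (atl i) z| = `|v| by rewrite distrC.
have seg_near t : 0 <= t <= 1 -> ball y d (y + t *: v).
  move=> /andP[t0 t1]; rewrite -ball_normE /= opprD addNKr normrN normrZ ger0_norm//.
  by apply: le_lt_trans vd; rewrite vn ler_piMl.
have hseg t : 0 <= t <= 1 -> ccod (atl i) (y + t *: v).
  by move=> /seg_near /hd[].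
have cg := segment_C1 hseg.
have jz : joins x z (rcons s (segment i y v)).
  apply: joins_rcons js cg _ _.
    by rewrite /segment scale0r addr0 cmapK.
  by rewrite /segment scale1r /v addrC subrK cmapK.
apply: (@le_lt_trans _ _ (l + K * `|v|)%:E).
  apply: (@le_trans _ _ (\sum_(gam <- rcons s (segment i y v)) curve_length gam)%E).
    by apply: ereal_inf_lbound; exists (rcons s (segment i y v)).
  rewrite big_rcons/= EFinD fineK// leeD//.
  apply: curve_length_le => // t t01; rewrite segment_speed//.
  by have /hd[_] := seg_near t t01; apply.
by rewrite lte_fin -ltrBrDl mulrC -ltr_pdivlMr// -vn.
Unshelve. all: by end_near. Qed.

End GeodesicBalls.

(** * The Riemannian measure *)

Section BorelSets.
Context (R : realType) (X : ptopologicalType).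

Lemma borel_open (A : set X) : open A -> measurable (A : set (borel X)).
Proof. exact: sub_sigma_algebra. Qed.

Lemma borel_closed (A : set X) : closed A -> measurable (A : set (borel X)).
Proof.
move=> cA; rewrite -[A]setCK; apply: measurableC; apply: borel_open.
exact: closed_openC.
Qed.

Lemma borel_continuous_on (A : set X) (f : X -> R) : open A ->
  (forall x, A x -> {for x, continuous f}) ->
  measurable_fun (A : set (borel X)) (f : borel X -> R).
Proof.
move=> oA cf; apply: (measurability _ (RGenOpens.measurableE R)).
move=> _ [_ [a [b ->]] <-]; apply: borel_open.
rewrite openE => x [Ax fx]; apply: filterI; first exact: open_nbhs_nbhs.
by apply: (cf x Ax); apply: open_nbhs_nbhs; split => //; exact: interval_open.
Qed.

Lemma borel_continuous (f : X -> R) : continuous f ->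
  measurable_fun [set: borel X] (f : borel X -> R).
Proof. by move=> cf; apply: (@borel_continuous_on [set: X] f) => [|x _]; [exact: openT|exact: cf]. Qed.

End BorelSets.

Section PositiveDefinite.
Context (R : realType) (n : nat) (A : 'M[R]_n).

(** The segment from the identity to [A] stays in the positive definite
    matrices, hence away from the zeros of the determinant. *)
Lemma posdef_det_gt0 :
  (forall v : 'rV[R]_n, v != 0 -> 0 < (v *m A *m v^T) 0 0) -> 0 < \det A.
Proof.
move=> posA; rewrite ltNge; apply/negP => dA.
pose B (t : R) : 'M[R]_n := (1 - t)%:M + t *: A.
have cB : continuous (fun t => \det (B t)).
  move=> t; apply: cvg_det => i j; rewrite !mxE; under eq_fun do rewrite !mxE.
  apply: cvgD; last by apply: cvgMl; exact: cvg_id.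
  by apply: cvgMn; apply: cvgB; [exact: cvg_cst|exact: cvg_id].
have B0 : \det (B 0) = 1 by rewrite /B subr0 scale0r addr0 det1.
have B1 : \det (B 1) = \det A.
  by rewrite /B subrr scale1r (_ : 0%:M = 0) ?add0r//; apply/matrixP => i j; rewrite !mxE mul0rn.
have [t] : exists2 t, t \in `[0, 1] & \det (B t) = 0.
  apply: IVT => //; first exact: continuous_subspaceT.
  by rewrite B0 B1 ge_min dA orbT/= le_max ler01.
rewrite in_itv/= => /andP[t0 t1] /eqP /det0P[v v0].
move=> /(congr1 (fun w => (w *m v^T) 0 0)); rewrite mul0mx [RHS]mxE.
have -> : (v *m B t *m v^T) 0 0 = (1 - t) * (v *m v^T) 0 0 + t * (v *m A *m v^T) 0 0.
  rewrite /B mulmxDr mulmxDl mul_mx_scalar -scalemxAr -!scalemxAl [LHS]mxE.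
  by congr (_ + _); rewrite [LHS]mxE.
have v2 : 0 < (v *m v^T) 0 0.
  have [k vk] : exists k, v 0 k != 0.
    apply/existsP; apply: contraNT v0; rewrite negb_exists => /forallP h.
    by apply/eqP/rowP => k; rewrite mxE; apply/eqP; have := h k; rewrite negbK.
  rewrite mxE (bigD1 k)//= mxE ltr_pwDl//; first by rewrite -expr2 exprn_even_gt0.
  by apply: sumr_ge0 => j _; rewrite mxE -expr2 sqr_ge0.
have := posA v v0; move: ((v *m v^T) 0 0) v2 => w w0; move: (_ 0 0) => q q0 E.
have : 0 < (1 - t) * w + t * q.
  have [->|t00] := eqVneq t 0; first by rewrite subr0 mul1r mul0r addr0.
  rewrite ltr_wpDl//; first by rewrite mulr_ge0 ?subr_ge0// ltW.
  by rewrite mulr_gt0// lt_neqAle eq_sym t00.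
by rewrite E ltxx.
Qed.

End PositiveDefinite.

Section LebesgueBalls.
Context (R : realType) (n : nat).
Variables (lam : {measure set (borel 'rV[R]_n) -> \bar R}) (lamP : is_lebesgue lam).

Definition box (a b : 'rV[R]_n) : set (borel 'rV[R]_n) :=
  [set x : 'rV[R]_n | forall i, a 0 i < x 0 i <= b 0 i].

Lemma box_measurable a b : measurable (box a b).
Proof.
have -> : box a b = \bigcap_(i in [set: 'I_n])
    ((fun x : borel 'rV[R]_n => x 0 i) @^-1` `]a 0 i, b 0 i]).
  apply/seteqP; split => x /= hx i; last by have := hx i I; rewrite /= in_itv.
  by move=> _; rewrite /= in_itv/=; exact: hx.
apply: fin_bigcap_measurable => // i _; rewrite -[X in measurable X]setTI.
have mi : measurable_fun [set: borel 'rV[R]_n] (fun x : borel 'rV[R]_n => x 0 i).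
  by apply: borel_continuous => x; exact: coord_continuous.
exact: mi.
Qed.

Lemma lebesgue_ball (c : 'rV[R]_n) (e : R) : 0 < e ->
  (0 < lam (ball c e))%E /\ (lam (ball c e) < +oo)%E.
Proof.
move=> e0; have mball : measurable (ball c e : set (borel 'rV[R]_n)).
  by apply: borel_open; exact: ball_open.
have lamE (r : R) : 0 < r -> lam (box (\row_i (c 0 i - r)) (\row_i (c 0 i + r))) =
    (\prod_(i < n) (r + r))%:E.
  move=> r0; rewrite lamP.
    by congr EFin; apply: eq_bigr => i _; rewrite !mxE; lra.
  by move=> i; rewrite !mxE; lra.
split.
  have e2 : 0 < e / 2 by rewrite divr_gt0.
  apply: (@lt_le_trans _ _ (lam (box (\row_i (c 0 i - e / 2)) (\row_i (c 0 i + e / 2))))).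
    by rewrite lamE// lte_fin prodr_gt0// => i _; rewrite addr_gt0.
  apply: le_measure; rewrite ?inE//; first exact: box_measurable.
  move=> x hx; split => // i j; rewrite ord1; have := hx j; rewrite !mxE => /andP[h1 h2].
  by rewrite /ball /= ltr_norml; apply/andP; split; lra.
apply: (@le_lt_trans _ _ (lam (box (\row_i (c 0 i - e)) (\row_i (c 0 i + e))))).
  apply: le_measure; rewrite ?inE//; first exact: box_measurable.
  move=> x [_ hx] i; have := hx 0 i; rewrite /ball /= ltr_norml !mxE => /andP[h1 h2].
  by apply/andP; split; lra.
by rewrite lamE// ltry.
Qed.

End LebesgueBalls.

Section RiemannianMeasure.
Context (R : realType) (n : nat) (M : riemannian_manifold R n).
Variable mu : {measure set (borel M) -> \bar R}.
Hypothesis mu_riem : is_riemannian_measure mu.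
Local Notation atl i := (ratlas i : chart R n M).

(** Coordinate balls. *)
Definition cball (x : M) (d : R) : set M :=
  cdom (atl (chart_at x)) `&`
  cmap (atl (chart_at x)) @^-1` ball (cmap (atl (chart_at x)) x) d.

Lemma cball_open x d : open (cball x d).
Proof.
rewrite openE => z [dz bz]; apply: filterI; first exact: near_cdom.
by apply: (cmap_cvg dz); apply: open_nbhs_nbhs; split => //; exact: ball_open.
Qed.

Lemma cball_center x d : 0 < d -> cball x d x.
Proof. by move=> d0; split; [exact: chart_atP|exact: ballxx]. Qed.

(** Near x the density sqrt (det g) lies between two positive constants. *)
Lemma cball_measure x : exists2 d : R, 0 < d & forall r, 0 < r -> r <= d ->
  (0 < mu (cball x r))%E /\ (mu (cball x r) < +oo)%E.
Proof.
have [lam lamP muE] := mu_riem.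
set i := chart_at x; have dx : cdom (atl i) x := chart_atP x.
have cx := cmap_ccod dx; set y := cmap (atl i) x in cx.
pose s (z : 'rV[R]_n) := Num.sqrt (\det (rmetric i z)).
have cs z : ccod (atl i) z -> {for z, continuous s}.
  move=> cz; exact: (@cvg_comp _ _ _ (fun z => \det (rmetric i z)) Num.sqrt (nbhs z)
    (nbhs (\det (rmetric i z))) _ (cvg_det (@metric_cvg _ _ _ i z cz))
    (@sqrt_continuous R _)).
have sy : 0 < s y.
  by rewrite sqrtr_gt0; apply: posdef_det_gt0 => v v0; exact: rmetric_pos.
have : \forall z \near y, [/\ ccod (atl i) z, s y / 2 <= s z & s z <= s y *+ 2].
  have h1 := near_ccod cx.
  have h2 : \forall z \near y, `|s y - s z| <= s y / 2.
    by have /cvgrPdist_le := cs y cx; apply; rewrite divr_gt0.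
  near=> z; have : `|s y - s z| <= s y / 2 by near: z.
  rewrite ler_norml => /andP[h3 h4].
  by split; [near: z|lra|lra].
move=> /nbhs_ballP[d /= d0 hd]; exists d => // r r0 rd.
have imE : cmap (atl i) @` cball x r = ball y r.
  apply/seteqP; split => [_ [z [dz bz] <-] //|z bz].
  have [cz _ _] := hd z (le_ball rd bz); have [dz zK] := ccodP cz.
  by exists (cinv (atl i) z); [split => //=; rewrite zK|].
have mB : measurable (ball y r : set (borel 'rV[R]_n)).
  by apply: borel_open; exact: ball_open.
have muB : mu (cball x r) = (\int[lam]_(z in (ball y r : set (borel 'rV[R]_n))) (s z)%:E)%E.
  rewrite (muE i); [by rewrite imE|by apply: borel_open; exact: cball_open|by move=> z []].
have ms : measurable_fun (ball y r : set (borel 'rV[R]_n)) (s : borel 'rV[R]_n -> R).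
  apply: borel_continuous_on; first exact: ball_open.
  by move=> z bz; apply: cs; have [] := hd z (le_ball rd bz).
have [lam0 lamoo] := lebesgue_ball lamP y r0.
rewrite muB; split.
  apply: (@lt_le_trans _ _ ((s y / 2)%:E * lam (ball y r))%E).
    by rewrite mule_gt0// lte_fin divr_gt0.
  rewrite -integral_cst//; apply: ge0_le_integral => //.
  - by move=> z _; rewrite lee_fin divr_ge0// ltW.
  - exact/measurable_EFinP.
  - by move=> z bz; rewrite lee_fin; have [] := hd z (le_ball rd bz).
apply: (@le_lt_trans _ _ ((s y *+ 2)%:E * lam (ball y r))%E).
  rewrite -integral_cst//; apply: ge0_le_integral => //.
  - by move=> z _; rewrite lee_fin sqrtr_ge0.
  - exact/measurable_EFinP.
  - by move=> z bz; rewrite lee_fin; have [] := hd z (le_ball rd bz).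
by rewrite lte_mul_pinfty// lee_fin mulrn_wge0// ltW.
Unshelve. all: by end_near. Qed.

Lemma compact_borel (K : set M) : compact K -> measurable (K : set (borel M)).
Proof.
move=> cK; apply: borel_closed.
exact: (compact_closed (@rpoint_hausdorff _ _ M)).
Qed.

Lemma compact_measure_lty (K : set M) : compact K -> (mu K < +oo)%E.
Proof.
move=> cK; have /choice[d hd] : forall x : M, exists d : R, 0 < d /\ (mu (cball x d) < +oo)%E.
  by move=> x; have [d d0 h] := cball_measure x; exists d; split => //; have [] := h d d0 (lexx _).
have := cK; rewrite compact_cover => /(_ _ setT (fun x => cball x (d x))).
case=> [x _|x _|D _ KD]; first exact: cball_open.
  by exists x => //; apply: cball_center; have [] := hd x.
have mU (s : seq M) : measurable (\bigcup_(x in [set` s]) cball x (d x) : set (borel M)).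
  by apply: borel_open; apply: bigcup_open => x _; exact: cball_open.
have Uoo (s : seq M) : (mu (\bigcup_(x in [set` s]) cball x (d x)) < +oo)%E.
  elim: s => [|x s IH]; first by rewrite bigcup_seq big_nil measure0.
  rewrite bigcup_seq big_cons -bigcup_seq.
  have mx : measurable (cball x (d x) : set (borel M)).
    by apply: borel_open; exact: cball_open.
  have := measureU2 mu mx (mU s) => /le_lt_trans; apply.
  by apply: lte_add_pinfty => //; have [] := hd x.
have := Uoo (finmap.enum_fset D); apply: le_lt_trans.
apply: le_measure; rewrite ?inE; [exact: compact_borel|exact: mU|].
by move=> x /KD[y yD xy]; exists y.
Qed.

Lemma compact_support_integrable (K : set M) (q : M -> R) : compact K ->
  continuous q -> (forall x, ~ K x -> q x = 0) ->
  mu.-integrable [set: borel M] (EFin \o q).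
Proof.
move=> cK cq q0; have mK := compact_borel cK.
have -> : EFin \o q = (EFin \o q) \_ K.
  apply/funext => x; rewrite patchE /=; case: ifPn => // /negP xK.
  by rewrite q0// => Kx; apply: xK; rewrite inE.
apply/(integrable_mkcond _ mK); apply: measurable_bounded_integrable => //.
- exact: compact_measure_lty.
- by apply: (measurable_funS measurableT) => //; exact: borel_continuous.
- have : compact (q @` K).
    by apply: continuous_compact => //; exact: continuous_subspaceT.
  move=> /compact_bounded[B [Br hB]]; exists B; split => // b Bb x Kx.
  by apply: (hB b Bb); exists x.
Qed.

End RiemannianMeasure.

(** * The Dirichlet form and the Laplacian *)

(** Moore-Osgood: uniformity in l of the limit in k allows the exchange. *)
Lemma double_limit (R : realType) (a : nat -> nat -> R) (b c : nat -> R) (x y : R) :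
  (forall l, a k l @[k --> \oo] --> b l) -> (forall k, a k l @[l --> \oo] --> c k) ->
  b @ \oo --> x -> c @ \oo --> y ->
  (forall e, 0 < e -> exists N, forall k m l, (N <= k)%N -> (N <= m)%N -> (N <= l)%N ->
     `|a k l - a m l| <= e) -> x = y.
Proof.
move=> ab ac bx cy ua; apply/eqP; rewrite -subr_eq0 -normr_le0.
apply/ler_addgt0Pl => e e0; rewrite addr0; have e4 : 0 < e / 4 by rewrite divr_gt0.
have [N hN] := ua _ e4.
have [k [Nk ck]] : exists k, (N <= k)%N /\ `|y - c k| <= e / 4.
  have := ((cvgrPdist_le _ _).1 cy) _ e4; move=> [K _ hK].
  by exists (maxn N K); split; [exact: leq_maxl|apply: hK; exact: leq_maxr].
have [l [Nl bl al]] : exists l, [/\ (N <= l)%N, `|x - b l| <= e / 4 & `|c k - a k l| <= e / 4].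
  have [K _ hK] := ((cvgrPdist_le _ _).1 bx) _ e4.
  have [K' _ hK'] := ((cvgrPdist_le _ _).1 (ac k)) _ e4.
  exists (maxn N (maxn K K')); split; first exact: leq_maxl.
    by apply: hK; rewrite /= !leq_max leqnn orbT.
  by apply: hK'; rewrite /= !leq_max leqnn !orbT.
have ba : `|a k l - b l| <= e / 4.
  have cv : `|a k l - a m l| @[m --> \oo] --> `|a k l - b l|.
    by apply: cvg_norm; apply: cvgB => //; exact: cvg_cst.
  rewrite -(cvg_lim _ cv)//; apply: limr_le; first by apply/cvg_ex; exists `|a k l - b l|.
  by exists N => // m /= Nm; exact: hN.
have -> : x - y = (x - b l) - (a k l - b l) + (- (c k - a k l)) + (- (y - c k)).
  by lra.
apply: le_trans (ler_normD _ _) _; rewrite normrN.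
apply: (@le_trans _ _ (e / 4 + e / 4 + e / 4 + e / 4)); last by lra.
rewrite lerD//; apply: le_trans (ler_normD _ _) _; rewrite normrN lerD//.
by apply: le_trans (ler_normB _ _) _; rewrite lerD.
Qed.

Section DirichletForm.
Context (R : realType) (n : nat) (M : riemannian_manifold R n).
Variable mu : {measure set (borel M) -> \bar R}.
Hypothesis mu_riem : is_riemannian_measure mu.
Local Notation atl i := (ratlas i : chart R n M).
Local Notation E := (dirichlet_form mu).

(** Weaker than being a test function, so as to be stable under linear
    combinations for simple reasons. *)
Definition C1c_fun (f : M -> R) : Prop :=
  C1_fun f /\ exists2 K : set M, compact K & forall x, ~ K x -> f x = 0.

Lemma test_C1c f : test_fun f -> C1c_fun f.
Proof. by move=> [sf Kf]; split => //; exact: smooth_C1. Qed.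

Lemma C1_lin (a : R) (f h : M -> R) : C1_fun f -> C1_fun h ->
  C1_fun (fun x => a * f x + h x).
Proof.
move=> cf ch i y cy.
have fE : (fun x => a * f x + h x) \o cinv (atl i) =
    a *: (f \o cinv (atl i)) + (h \o cinv (atl i)) by [].
rewrite fE; have [df dfc] := cf i y cy; have [dh dhc] := ch i y cy.
split; first by apply: differentiableD => //; exact: differentiableZ.
move=> k.
have cvE : a * 'D_(delta_mx 0 k) (f \o cinv (atl i)) z +
    'D_(delta_mx 0 k) (h \o cinv (atl i)) z @[z --> y] -->
    a * 'D_(delta_mx 0 k) (f \o cinv (atl i)) y +
    'D_(delta_mx 0 k) (h \o cinv (atl i)) y.
  apply: (@cvgD _ _ _ (nbhs y)); last exact: (dhc k).
  by apply: (@cvgM _ _ (nbhs y)); [exact: cvg_cst|exact: (dfc k)].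
have dE z : ccod (atl i) z ->
    'D_(delta_mx 0 k) (a *: (f \o cinv (atl i)) + (h \o cinv (atl i))) z =
    a * 'D_(delta_mx 0 k) (f \o cinv (atl i)) z +
    'D_(delta_mx 0 k) (h \o cinv (atl i)) z.
  move=> cz; have [dfz _] := cf i z cz; have [dhz _] := ch i z cz.
  rewrite deriveD; last 2 first.
  - by apply: derivableZ; exact: diff_derivable.
  - exact: diff_derivable.
  by rewrite deriveZ//; exact: diff_derivable.
have : 'D_(delta_mx 0 k) (a *: (f \o cinv (atl i)) + (h \o cinv (atl i))) z
    @[z --> y] -->
    'D_(delta_mx 0 k) (a *: (f \o cinv (atl i)) + (h \o cinv (atl i))) y.
  rewrite dE//; apply: cvg_trans cvE; apply: (@near_eq_cvg _ _ (nbhs y)).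
  by apply: filterS (near_ccod cy) => z cz; rewrite dE.
exact.
Qed.

Lemma C1c_lin (a : R) (f h : M -> R) : C1c_fun f -> C1c_fun h ->
  C1c_fun (fun x => a * f x + h x).
Proof.
move=> [cf [K cK f0]] [ch [K' cK' h0]]; split; first exact: C1_lin.
exists (K `|` K'); first exact: compactU.
by move=> x /not_orP[/f0 -> /h0 ->]; rewrite mulr0 addr0.
Qed.

Lemma gradient_lin (a : R) (f h : M -> R) x : C1_fun f -> C1_fun h ->
  gradient (fun x => a * f x + h x) x = a *: gradient f x + gradient h x.
Proof.
move=> cf ch; rewrite /gradient scalemxAl -mulmxDl; congr (_ *m _).
have cx := cmap_ccod (chart_atP x).
have [df _] := cf _ _ cx; have [dh _] := ch _ _ cx.
apply/rowP => k; rewrite !mxE.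
have -> : (fun x => a * f x + h x) \o cinv (chart_of x) =
    a *: (f \o cinv (chart_of x)) + (h \o cinv (chart_of x)) by [].
rewrite deriveD; last 2 first.
- by apply: derivableZ; exact: diff_derivable.
- exact: diff_derivable.
by rewrite deriveZ//; exact: diff_derivable.
Qed.

Lemma gradient_out (f : M -> R) (K : set M) x : compact K ->
  (forall x, ~ K x -> f x = 0) -> ~ K x -> gradient f x = 0.
Proof.
move=> cK f0 Kx; have dx := chart_atP x; have cx := cmap_ccod dx.
have oK : open (~` K).
  by apply: closed_openC; exact: (compact_closed (@rpoint_hausdorff _ _ M)).
have fz : \forall y \near cmap (chart_of x) x, (f \o cinv (chart_of x)) y = cst 0 y.
  have : \forall y \near cmap (chart_of x) x, (~` K) (cinv (chart_of x) y).
    by apply: (cinv_cvg cx); rewrite cmapK//; exact: open_nbhs_nbhs.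
  by apply: filterS => y /f0.
rewrite /gradient; apply/rowP => k; rewrite !mxE big1// => l _.
by rewrite mxE (near_eq_derive _ fz) derive_cst mul0r.
Qed.

Lemma grad_pairing_integrable (f h : M -> R) : C1c_fun f -> C1c_fun h ->
  mu.-integrable [set: borel M] (EFin \o grad_pairing f h).
Proof.
move=> [cf [K cK f0]] [ch _]; apply: (compact_support_integrable mu_riem cK).
  exact: grad_pairing_continuous.
by move=> x Kx; rewrite /grad_pairing /tangent_dot (gradient_out cK f0 Kx) !mul0mx mxE.
Qed.

Lemma dirichletC f h : E f h = E h f.
Proof. by apply: eq_Rintegral => x _; rewrite tangent_dotC. Qed.

Lemma dirichlet_ge0 f : 0 <= E f f.
Proof. by apply: Rintegral_ge0 => x _; exact: tangent_dot_ge0. Qed.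

Lemma dirichlet_lin (a : R) f g h : C1c_fun f -> C1c_fun g -> C1c_fun h ->
  E (fun x => a * f x + g x) h = a * E f h + E g h.
Proof.
move=> cf cg ch.
have If := grad_pairing_integrable cf ch; have Ig := grad_pairing_integrable cg ch.
rewrite /dirichlet_form -RintegralZl// -RintegralD//; last first.
  have := @integrableZl _ _ _ mu _ measurableT a _ If.
  by apply: eq_integrable => // x _; rewrite /= EFinM.
apply: eq_Rintegral => x _; rewrite gradient_lin ?tangent_dot_lin//.
  by case: cf.
by case: cg.
Qed.

Lemma dirichlet_sub f g h : C1c_fun f -> C1c_fun g -> C1c_fun h ->
  E (f \- g) h = E f h - E g h.
Proof.
move=> cf cg ch.
have -> : f \- g = (fun x => (-1) * g x + f x).
  by apply/funext => x /=; rewrite mulN1r addrC.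
by rewrite dirichlet_lin// mulN1r addrC.
Qed.

Lemma C1c_sub f g : C1c_fun f -> C1c_fun g -> C1c_fun (f \- g).
Proof.
move=> cf cg; have -> : f \- g = (fun x => (-1) * g x + f x).
  by apply/funext => x /=; rewrite mulN1r addrC.
exact: C1c_lin.
Qed.

Lemma dirichlet_cauchy_schwarz f h : C1c_fun f -> C1c_fun h ->
  `|E f h| <= Num.sqrt (E f f) * Num.sqrt (E h h).
Proof.
move=> cf ch.
have : E f h ^+ 2 <= E f f * E h h.
  apply: quadratic_cauchy_schwarz; first exact: dirichlet_ge0.
  move=> a; have cl := C1c_lin a cf ch.
  have := dirichlet_ge0 (fun x => a * f x + h x).
  rewrite (dirichlet_lin a cf ch cl) (dirichletC f) (dirichletC h).
  rewrite (dirichlet_lin a cf ch cf) (dirichlet_lin a cf ch ch) (dirichletC h f).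
  by move: (E f f) (E f h) (E h h) => A B C; lra.
move: (E f f) (E h h) (E f h) (dirichlet_ge0 f) => A B C A0 CAB.
by rewrite -sqrtrM// -sqrtr_sqr ler_wsqrtr.
Qed.

Lemma dirichlet_bounded (phi : nat -> M -> R) : (forall k, test_fun (phi k)) ->
  (forall e : R, 0 < e -> exists N : nat, forall k l : nat,
     (N <= k)%N -> (N <= l)%N -> E (phi k \- phi l) (phi k \- phi l) < e) ->
  exists B N, forall l, (N <= l)%N -> E (phi l) (phi l) <= B.
Proof.
move=> tphi /(_ 1 ltr01)[N hN]; exists (2 + 2 * E (phi N) (phi N)), N => l Nl.
have cl := test_C1c (tphi l); have cN := test_C1c (tphi N).
have cd := C1c_sub cl cN.
have := hN l N Nl (leqnn N).
(* E (d + g) <= 2 E d + 2 E g, since E (d - g) >= 0. *)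
have := dirichlet_ge0 ((phi l \- phi N) \- phi N).
have cd2 := C1c_sub cd cN.
rewrite !dirichlet_sub// ![E _ (_ \- _)]dirichletC !dirichlet_sub//.
rewrite [E (phi N) (phi l)]dirichletC.
by move: (E (phi l) (phi l)) (E (phi l) (phi N)) (E (phi N) (phi N)) => A B C; lra.
Qed.

Lemma one_le_two : (1 <= 2%:E :> \bar R)%E. Proof. by rewrite lee_fin ler1n. Qed.
Local Notation V := (LfunType mu one_le_two).
Local Notation ip := (@L2_inner _ _ _ mu one_le_two).
Local Notation nrm := (semi_norm ip).

Lemma C1c_L2 f : C1c_fun f -> L2 mu f.
Proof.
move=> [cf [K cK f0]]; have ctf := C1_continuous cf.
apply: sqr_integral_L2; first exact: borel_continuous.
have : mu.-integrable [set: borel M] (EFin \o (fun x => f x ^+ 2)).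
  apply: (compact_support_integrable mu_riem cK).
    by move=> x; apply: cvgM; exact: ctf.
  by move=> x Kx; rewrite f0// expr0n.
move=> /integrableP[_]; apply: le_lt_trans; apply: le_of_eq; apply: eq_integral => x _.
by rewrite /= ger0_norm ?sqr_ge0.
Qed.

Lemma L2_cvg_inner (w u : V) (phi : nat -> M -> R) : (forall k, L2 mu (phi k)) ->
  L2_norm mu (phi k \- u) @[k --> \oo] --> 0%E ->
  (\int[mu]_x (w x * phi k x)) @[k --> \oo] --> \int[mu]_x (w x * u x).
Proof.
move=> L2phi /fine_cvgP[_ cphi]; pose F k : V := Lfun_Sub one_le_two (L2phi k).
have nE k : fine (L2_norm mu (phi k \- u)) = nrm (F k - u).
  by rewrite /L2_norm -[fine _]/(fine (Lnorm mu 2%:E (EFin \o (F k - u : V)))) L2_normE.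
apply/cvgrPdist_le => e e0.
have w1 : 0 < nrm w + 1 by rewrite ltr_wpDl ?sqrtr_ge0.
have := ((cvgrPdist_le _ _).1 cphi) _ (divr_gt0 e0 w1).
move=> [N _ hN]; exists N => // k Nk; have := hN k Nk.
rewrite /= sub0r normrN nE ger0_norm ?sqrtr_ge0// => hk.
have inner := @L2_inner_is_semi_inner _ _ _ mu one_le_two.
have -> : \int[mu]_x (w x * u x) - \int[mu]_x (w x * phi k x) = - ip (F k - u) w.
  rewrite (ipBl inner) opprB ![ip _ w](semi_innerC inner).
  by [].
rewrite normrN; apply: le_trans (ip_le_nrm inner _ _) _.
apply: (@le_trans _ _ (e / (nrm w + 1) * (nrm w + 1))).
  by rewrite ler_pM ?sqrtr_ge0// lerDl.
by rewrite divfK// gt_eqF.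
Qed.

(** With phi, psi the sequences of test functions attached to u and u', both
    sides are iterated limits of E (phi k) (psi l), and the Cauchy-Schwarz
    inequality for E makes the limit in k uniform in l. *)
Lemma laplace_beltrami_sym (u v u' v' : V) :
  laplace_beltrami mu u v -> laplace_beltrami mu u' v' -> ip v u' = ip u v'.
Proof.
move=> [_ _ [phi [tphi phiu Cphi Ephi]]] [_ _ [psi [tpsi psiu Cpsi Epsi]]].
have cphi k := test_C1c (tphi k); have cpsi k := test_C1c (tpsi k).
apply: (@double_limit _ (fun k l => E (phi k) (psi l))
  (fun l => \int[mu]_x (v x * psi l x)) (fun k => \int[mu]_x (v' x * phi k x))).
- by move=> l; exact: Ephi.
- move=> k; under eq_fun do rewrite dirichletC; exact: Epsi.
- by apply: L2_cvg_inner => // k; exact: C1c_L2.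
- rewrite (semi_innerC (@L2_inner_is_semi_inner _ _ _ mu one_le_two)).
  by apply: L2_cvg_inner => // k; exact: C1c_L2.
move=> e e0; have [B [N hB]] := dirichlet_bounded tpsi Cpsi.
have B1 : 0 < `|B| + 1 by rewrite ltr_wpDl.
have [N' hN'] := Cphi (e ^+ 2 / (`|B| + 1)) (divr_gt0 (exprn_gt0 _ e0) B1).
exists (maxn N N') => k m l; rewrite !geq_max => /andP[_ k'] /andP[_ m'] /andP[l1 _].
rewrite -dirichlet_sub//; apply: le_trans (dirichlet_cauchy_schwarz (C1c_sub _ _) _) _ => //.
rewrite -sqrtrM ?dirichlet_ge0// -(ger0_norm (ltW e0)) -sqrtr_sqr ler_wsqrtr//.
apply: (@le_trans _ _ (e ^+ 2 / (`|B| + 1) * (`|B| + 1))); last by rewrite divfK// gt_eqF.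
rewrite ler_pM ?dirichlet_ge0//; first exact/ltW/hN'.
by apply: le_trans (hB l l1) _; have := ler_norm B; lra.
Qed.

End DirichletForm.

(** * The heat semigroup on L^2 *)

Lemma at_right_ex (R : realType) (P : R -> Prop) : (\forall t \near 0^'+, P t) ->
  exists2 d, 0 < d & forall t, 0 < t -> t <= d -> P t.
Proof.
rewrite near_withinE => /nbhs_ballP[d /= d0 hd].
exists (d / 2); first by rewrite divr_gt0.
move=> t t0 td; apply: hd => //=.
by rewrite /ball /= sub0r normrN gtr0_norm//; lra.
Qed.

Lemma ae_mono d (T : measurableType d) (R : realType)
    (mu : {measure set T -> \bar R}) (P Q : T -> Prop) :
  (forall x, P x -> Q x) -> {ae mu, forall x, P x} -> {ae mu, forall x, Q x}.
Proof. by move=> PQ; apply: filterS. Qed.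

Lemma ae_le_Rintegral d (T : measurableType d) (R : realType)
    (mu : {measure set T -> \bar R}) (f g : T -> R) :
  mu.-integrable setT (EFin \o f) -> mu.-integrable setT (EFin \o g) ->
  {ae mu, forall x, f x <= g x} -> \int[mu]_x f x <= \int[mu]_x g x.
Proof.
move=> If Ig fg; rewrite -subr_ge0 -RintegralB//.
have mf : measurable_fun setT f by apply/measurable_EFinP; exact: measurable_int If.
have mg : measurable_fun setT g by apply/measurable_EFinP; exact: measurable_int Ig.
have -> : \int[mu]_x (g x - f x) = \int[mu]_x Num.max (g x - f x) 0.
  congr fine; apply: ae_eq_integral => //.
  - by apply/measurable_EFinP; exact: measurable_funB.
  - by apply/measurable_EFinP; apply: measurable_maxr => //; exact: measurable_funB.
  by apply: filterS fg => x fgx _; rewrite max_l// subr_ge0.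
by apply: Rintegral_ge0 => x _; rewrite le_max lexx orbT.
Qed.

Section HeatOnL2.
Context (R : realType) (n : nat) (M : riemannian_manifold R n).
Variable mu : {measure set (borel M) -> \bar R}.
Hypothesis mu_riem : is_riemannian_measure mu.
Local Notation V := (LfunType mu (one_le_two R)).
Local Notation ip := (@L2_inner _ _ _ mu (one_le_two R)).
Local Notation nrm := (semi_norm ip).
Variables (S : R -> (M -> R) -> M -> R) (hS : is_heat_semigroup mu S).

Let inner := @L2_inner_is_semi_inner _ _ _ mu (one_le_two R).

(** The absolute value makes the operators total in the time. *)
Definition heat (t : R) (f : V) : V :=
  Lfun_Sub (one_le_two R) (heat_L2 hS (normr_ge0 t) (LfunP f)).

Lemma heatE t (f : V) : 0 <= t -> (heat t f : M -> R) = S t f.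
Proof. by move=> t0; rewrite /= ger0_norm. Qed.

Lemma inner_ae (f g h : V) : {ae mu, forall x, f x = g x} -> ip f h = ip g h.
Proof.
move=> fg; congr fine; apply: ae_eq_integral => //.
- by apply/measurable_EFinP; apply: measurable_funM; exact: measurable_L2.
- by apply/measurable_EFinP; apply: measurable_funM; exact: measurable_L2.
by apply: filterS fg => x -> .
Qed.

Lemma nrmE (f : V) (g : M -> R) : g = f -> L2_norm mu g = (nrm f)%:E.
Proof. by move=> ->; exact: L2_normE. Qed.

Lemma heat_csg : is_contraction_semigroup ip heat.
Proof.
split=> [t a f h g t0|t f t0|s t f g s0 t0|f e e0].
- rewrite -(semi_innerP inner); apply: inner_ae.
  have hl : {ae mu, forall x, S t (fun y => a * f y + h y) x = a * S t f x + S t h x}.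
    exact: heat_linear (LfunP f) (LfunP h).
  apply: ae_mono hl => x.
  by rewrite /= ger0_norm.
- rewrite -lee_fin -(nrmE (esym (heatE f t0))) -(nrmE (erefl (f : M -> R))).
  exact: heat_contraction (LfunP f).
- apply: inner_ae; rewrite heatE ?addr_ge0// heatE// heatE//.
  exact: heat_add (LfunP f).
have [_ /cvgrPdist_le /(_ e e0) /at_right_ex[d d0 hd]] :=
  (fine_cvgP _ _).1 (heat_continuous hS (LfunP f)).
exists d => // t; rewrite le_eqVlt => /predU1P[<- _|t0 td].
  suff -> : nrm (heat 0 f - f) = 0 by exact: ltW.
  have h0 : ip (heat 0 f - f) (heat 0 f - f) = 0.
    have -> : ip (heat 0 f - f) (heat 0 f - f) = ip 0 (heat 0 f - f).
      apply: inner_ae; apply: ae_mono (heat_0 hS (LfunP f)) => x fx.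
      have -> : (heat 0 f - f : V) x = heat 0 f x - f x by [].
      by rewrite heatE// fx subrr.
    exact: ip0l.
  by rewrite /semi_norm h0 sqrtr0.
have nE : L2_norm mu (S t f \- f) = (nrm (heat t f - f))%:E.
  by apply: nrmE; apply/funext => x /=; rewrite (ger0_norm (ltW t0)).
by have := hd t t0 td; rewrite /= sub0r normrN nE /= ger0_norm ?sqrtr_ge0.
Qed.

Lemma generates_laplace (u v : V) : generates ip heat u v -> laplace_beltrami mu u v.
Proof.
move=> uv; apply/(heat_generator hS (LfunP u) (LfunP v)).
pose F t : V := t^-1 *: (heat t u - u) + v.
have nE t : 0 < t -> L2_norm mu (fun x => t^-1 * (S t u x - u x) + v x) = (nrm (F t))%:E.
  by move=> t0; apply: nrmE; apply/funext => x /=; rewrite (ger0_norm (ltW t0)).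
have h : (nrm (F t))%:E @[t --> 0^'+] --> 0%E.
  apply: cvg_EFin; first by apply: nearW.
  apply/cvgrPdist_le => e e0; have [d d0 hd] := uv e e0.
  near=> t; have t0 : 0 < t by near: t; exact: nbhs_right_gt.
  have td : t <= d by near: t; exact: nbhs_right_le.
  rewrite /= sub0r normrN ger0_norm ?sqrtr_ge0//.
  have -> : F t = t^-1 *: (heat t u - u + t *: v).
    by rewrite scalerDr scalerA mulVf ?gt_eqF// scale1r.
  rewrite (nrmZ inner) ger0_norm ?invr_ge0 ?(ltW t0)//.
  by rewrite ler_pdivrMl// mulrC; exact: hd.
apply: cvg_trans h; apply: near_eq_cvg; near=> t; apply/esym/nE.
by near: t; exact: nbhs_right_gt.
Unshelve. all: by end_near. Qed.

Lemma heat_nrm_le t (f : V) : 0 <= t -> nrm (heat t f) ^+ 2 <= ip (heat t f) f.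
Proof.
apply: csg_nrm_le; [exact: inner|exact: heat_csg| |exact: L2_complete].
move=> u v u' v' /generates_laplace uv /generates_laplace uv'.
exact: laplace_beltrami_sym uv uv'.
Qed.

End HeatOnL2.

(** * The heat kernel on the diagonal *)

Section SmoothKernels.
Context (R : realType) (n : nat) (M : riemannian_manifold R n).
Local Notation atl i := (ratlas i : chart R n M).
Variables (f : M -> M -> R) (sf : smooth_fun2 f).

Let F i j (z : 'rV[R]_(n + n)) : R :=
  f (cinv (atl i) (lsubmx z)) (cinv (atl j) (rsubmx z)).

Lemma smooth_fun2_joint x w (e : R) : 0 < e -> exists2 d, 0 < d &
  forall x' w', cball x d x' -> cball w d w' -> `|f x' w' - f x w| <= e.
Proof.
move=> e0; have dx := chart_atP x; have dw := chart_atP w.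
pose z0 := row_mx (cmap (atl (chart_at x)) x) (cmap (atl (chart_at w)) w).
have dF : differentiable (F (chart_at x) (chart_at w)) z0.
  suff : [set z | ccod (atl (chart_at x)) (lsubmx z) /\ ccod (atl (chart_at w)) (rsubmx z)] z0.
    exact: (@sf (chart_at x) (chart_at w) [::] z0).
  rewrite /= /z0.
  by rewrite row_mxKl row_mxKr; split; exact: cmap_ccod.
have /cvgrPdist_le /(_ e e0) /nbhs_ballP[d /= d0 hd] := differentiable_continuous dF.
exists d => // x' w' [dx' bx] [dw' bw].
have : ball z0 d (row_mx (cmap (atl (chart_at x)) x') (cmap (atl (chart_at w)) w')).
  split => // i k; rewrite ord1 /z0 !mxE; case: splitP => l _.
    by case: bx => _; apply.
  by case: bw => _; apply.
move=> /hd /=; rewrite /F /z0 !row_mxKl !row_mxKr distrC.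
rewrite !cmapK//.
Qed.

(** Freezing the second variable amounts to restricting to an affine subspace
    of the product chart. *)
Lemma smooth_fun2_C1 w : C1_fun (fun x => f x w).
Proof.
move=> i y cy; set j := chart_at w; have dw : cdom (atl j) w := chart_atP w.
pose c := cmap (atl j) w; pose G := F i j.
have hF z : ccod (atl i) (lsubmx z) -> ccod (atl j) (rsubmx z) ->
    forall s, differentiable (foldr (fun k h y => 'D_(delta_mx 0 k) h y) G s) z.
  by move=> c1 c2 s; exact: (@sf i j s z (conj c1 c2)).
have fE : (fun x => f x w) \o cinv (atl i) = (fun y => G (row_mx y c)).
  by apply/funext => y'; rewrite /G /F row_mxKl row_mxKr /c cmapK.
have dr (y1 : 'rV[R]_n) : differentiable (fun y' : 'rV[R]_n => row_mx y' c) y1.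
  apply: differentiable_rV => k.
  have -> : (fun y' : 'rV[R]_n => (row_mx y' c : 'rV[R]_(n + n)) 0 k) =
      (fun y' => match fintype.split k with inl l => y' 0 l | inr l => c 0 l end).
    by apply/funext => y'; rewrite mxE.
  by case: (fintype.split k) => l; [exact: differentiable_coord|exact: differentiable_cst].
have cr y1 : ccod (atl i) y1 -> forall s,
    differentiable (foldr (fun k h y => 'D_(delta_mx 0 k) h y) G s) (row_mx y1 c).
  by move=> c1 s; apply: hF; rewrite ?row_mxKl ?row_mxKr//; exact: cmap_ccod.
rewrite fE; split.
  exact: (@differentiable_comp _ _ _ _ (fun y' : 'rV[R]_n => row_mx y' c) G y
    (dr y) (cr y cy [::])).
move=> k; have dE (y1 : 'rV[R]_n) : 'D_(delta_mx 0 k) (fun y' => G (row_mx y' c)) y1 =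
    'D_(delta_mx 0 (lshift n k)) G (row_mx y1 c).
  rewrite /derive; set g := (X in lim (fmap X _)); set g' := (X in _ = lim (fmap X _)).
  suff -> : g = g' by []. apply/funext => q; rewrite /g /g' /=; congr (_ *: (G _ - _)).
  apply/rowP => l; rewrite !mxE; case: splitP => l' ll'; rewrite ?mxE.
    by congr (_ * _%:R + _); rewrite -!val_eqE /= ll'.
  rewrite (_ : l == lshift n k = false) ?mulr0 ?add0r//.
  by apply/negbTE/eqP => kE; have := ltn_ord k; move: ll'; rewrite kE /= => ->; rewrite ltnNge leq_addr.
have -> : 'D_(delta_mx 0 k) (fun y' => G (row_mx y' c)) =
    'D_(delta_mx 0 (lshift n k)) G \o (fun y' => row_mx y' c).
  by apply/funext => y1; exact: dE.
apply: continuous_comp; first exact/differentiable_continuous/dr.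
exact/differentiable_continuous/(cr y cy [:: lshift n k]).
Qed.

End SmoothKernels.

Section KernelBound.
Context (R : realType) (n : nat) (M : riemannian_manifold R n).
Variable mu : {measure set (borel M) -> \bar R}.
Hypothesis mu_riem : is_riemannian_measure mu.
Local Notation V := (LfunType mu (one_le_two R)).
Local Notation ip := (@L2_inner _ _ _ mu (one_le_two R)).
Local Notation nrm := (semi_norm ip).

(** Pairing with this function takes the mean over [U]. *)
Definition mean_fun (U : set M) (y : M) : R := (fine (mu U))^-1 * \1_U y.

Section Mean.
Variables (U : set M) (mU : measurable (U : set (borel M))).
Hypotheses (U0 : (0 < mu U)%E) (Uoo : (mu U < +oo)%E).

Let m0 : 0 < fine (mu U).
Proof. by rewrite fine_gt0// U0 Uoo. Qed.

Lemma mean_fun_ge0 y : 0 <= mean_fun U y.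
Proof. by rewrite mulr_ge0 ?invr_ge0 ?(ltW m0). Qed.

Lemma mean_fun_measurable : measurable_fun [set: borel M] (mean_fun U : borel M -> R).
Proof. by apply: measurable_funM => //; exact: measurable_indic. Qed.

Lemma indic_integrable : mu.-integrable [set: borel M] (EFin \o (\1_U : borel M -> R)).
Proof.
apply/integrableP; split; first exact/measurable_EFinP/measurable_indic.
under eq_integral do rewrite /= ger0_norm//.
by rewrite integral_indic// setIT.
Qed.

Lemma mean_fun_integrable (c : R) :
  mu.-integrable [set: borel M] (EFin \o (fun y => c * mean_fun U y)).
Proof.
have := @integrableZl _ _ _ mu _ measurableT (c / fine (mu U)) _ indic_integrable.
by apply: eq_integrable => // y _; rewrite /= -EFinM mulrA.
Qed.

Lemma mean_fun_integral (c : R) : \int[mu]_y (c * mean_fun U y) = c.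
Proof.
rewrite /mean_fun; under eq_Rintegral do rewrite mulrA.
rewrite RintegralZl//; last exact: indic_integrable.
rewrite /Rintegral integral_indic// setIT -mulrA mulVf ?mulr1//.
by rewrite gt_eqF.
Qed.

Lemma mean_fun_L2 : L2 mu (mean_fun U).
Proof.
apply: sqr_integral_L2; first exact: mean_fun_measurable.
have := mean_fun_integrable (fine (mu U))^-1 => /integrableP[_].
apply: le_lt_trans; apply: le_of_eq.
apply: eq_integral => y _; rewrite /= ger0_norm; last first.
  by rewrite mulr_ge0 ?mean_fun_ge0// invr_ge0 ltW.
congr EFin; rewrite /mean_fun exprMn expr2 -mulrA; congr (_ * (_ * _)).
by rewrite indicE; case: (_ \in _); rewrite ?expr1n ?expr0n.
Qed.

Lemma mean_fun_between (q : M -> R) (c c' : R) :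
  mu.-integrable [set: borel M] (EFin \o (fun y => q y * mean_fun U y)) ->
  (forall y, U y -> c <= q y <= c') ->
  c <= \int[mu]_y (q y * mean_fun U y) <= c'.
Proof.
move=> Iq cq.
have pt y : c * mean_fun U y <= q y * mean_fun U y <= c' * mean_fun U y.
  rewrite /mean_fun indicE; case: (boolP (y \in U)) => /= [|_]; last first.
    by rewrite !mulr0 lexx.
  rewrite inE => /cq /andP[h1 h2].
  by rewrite !ler_wpM2r ?mulr1 ?invr_ge0 ?(ltW m0).
rewrite -{1}(mean_fun_integral c) -(mean_fun_integral c').
by apply/andP; split; apply: le_Rintegral => //;
  [exact: mean_fun_integrable| |exact: mean_fun_integrable|];
  move=> y _; have /andP[] := pt y.
Qed.

End Mean.

Variables (p : R -> M -> M -> R) (p_heat : is_heat_kernel mu p).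

(** For g the mean over a small ball around x, |S_t g|^2 <= <S_t g, g> in L^2.
    As the ball shrinks to x, S_t g tends to p_t(., x) and <S_t g, g> to
    p_t(x, x); Fatou's lemma passes to the limit on the left. *)
Lemma heat_kernel_sqr_le t x : 0 < t ->
  (\int[mu]_z ((p t z x) ^+ 2)%:E <= (p t x x)%:E)%E.
Proof.
move=> t0; have [p_gt0 p_smooth [S hS pS]] := p_heat.
have t0' := ltW t0; have sp := p_smooth t t0.
have [d0 d00 hd0] := cball_measure mu_riem x.
pose r k : R := d0 / k.+1%:R.
have r0 k : 0 < r k by rewrite divr_gt0.
have rd k : r k <= d0 by rewrite ler_pdivrMr// ler_peMr ?(ltW d00)// ler1n.
have r_small d : 0 < d -> exists N, forall k, (N <= k)%N -> r k <= d.
  move=> dp; exists (Num.truncn (d0 / d)) => k Nk.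
  rewrite ler_pdivrMr// mulrC -ler_pdivrMr//.
  by apply/ltW/(lt_le_trans (truncnS_gt _)); rewrite ler_nat.
pose U k := cball x (r k).
have mU k : measurable (U k : set (borel M)).
  by apply: borel_open; exact: cball_open.
have U0 k : (0 < mu (U k))%E by have [] := hd0 _ (r0 k) (rd k).
have Uoo k : (mu (U k) < +oo)%E by have [] := hd0 _ (r0 k) (rd k).
have Usub k d : r k <= d -> U k `<=` cball x d.
  by move=> rkd z [dz bz]; split => //; exact: le_ball rkd _ bz.
pose g k : V := Lfun_Sub (one_le_two R) (mean_fun_L2 (mU k) (U0 k) (Uoo k)).
have gE k : {ae mu, forall z,
    mu.-integrable [set: borel M] (EFin \o (fun y => p t z y * mean_fun (U k) y)) /\
    S t (g k) z = \int[mu]_y (p t z y * mean_fun (U k) y)}.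
  exact: pS (LfunP (g k)).
apply/lee_addgt0Pr => e e0.
have [d dp hd] := smooth_fun2_joint sp x x e0.
have [N hN] := r_small _ dp.
have inner_le k : (N <= k)%N -> ip (heat hS t (g k)) (g k) <= p t x x + e.
  move=> Nk; rewrite -[leRHS](mean_fun_integral (mU k) (U0 k) (Uoo k)).
  apply: ae_le_Rintegral.
  - exact: L2_integrableM.
  - exact: mean_fun_integrable.
  apply: ae_mono (gE k) => z [Iz Sz].
  rewrite heatE// Sz; have [Uz|Uz] := pselect (U k z); last first.
    have -> : g k z = 0 by rewrite /= /mean_fun indicE memNset ?mulr0.
    by rewrite /mean_fun indicE memNset ?mulr0.
  rewrite ler_wpM2r//; first exact: mean_fun_ge0.
  have close y : U k y -> p t x x - e <= p t z y <= p t x x + e.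
    move=> Uy; rewrite -ler_distl.
    exact: hd (Usub _ _ (hN k Nk) _ Uz) (Usub _ _ (hN k Nk) _ Uy).
  by have /andP[_] := mean_fun_between (mU k) (U0 k) (Uoo k) Iz close.
apply: (@ge0_fatou_le _ _ _ mu (fun k z => (heat hS t (g (k + N)%N) z) ^+ 2)).
- by move=> k; apply: measurable_funX; exact: measurable_L2.
- by move=> k z; rewrite sqr_ge0.
- apply: measurable_funX; apply: borel_continuous.
  exact/C1_continuous/smooth_fun2_C1.
- by move=> z; rewrite sqr_ge0.
- have gE' : {ae mu, forall z, forall k,
      mu.-integrable [set: borel M] (EFin \o (fun y => p t z y * mean_fun (U k) y)) /\
      S t (g k) z = \int[mu]_y (p t z y * mean_fun (U k) y)}.
    exact/ae_foralln.
  apply: ae_mono gE' => z Hz.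
  suff h : heat hS t (g k) z @[k --> \oo] --> p t z x.
    have h' : heat hS t (g (k + N)%N) z @[k --> \oo] --> p t z x.
      by have := h; rewrite -(cvg_shiftn N).
    by apply: cvgM.
  apply/cvgrPdist_le => e' e'0.
  have [d' dp' hd'] := smooth_fun2_joint sp z x e'0.
  have [N' hN'] := r_small _ dp'.
  exists N' => // k Nk; have [Iz Sz] := Hz k.
  rewrite heatE// Sz distrC ler_distl.
  apply: (mean_fun_between (mU k) (U0 k) (Uoo k) Iz) => y Uy.
  have := hd' z y (cball_center _ dp') (Usub _ _ (hN' k Nk) _ Uy).
  by rewrite ler_distl.
- move=> k; rewrite -L2_innerE -(sqr_nrm (@L2_inner_is_semi_inner _ _ _ mu (one_le_two R))).
  rewrite -EFinD lee_fin; apply: le_trans (heat_nrm_le mu_riem hS (g (k + N)%N) t0') _.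
  by apply: inner_le; exact: leq_addl.
Qed.

Lemma volume_sqr_le t x (rad b : R) : 0 < t -> 0 <= b ->
  (forall z, geodesic_ball x rad z -> b <= p t z x) ->
  ((b ^+ 2)%:E * volume mu x rad <= (p t x x)%:E)%E.
Proof.
move=> t0 b0 hb; apply: le_trans (heat_kernel_sqr_le x t0).
have mB : measurable (geodesic_ball x rad : set (borel M)).
  by apply: borel_open; exact: geodesic_ball_open.
have mp : measurable_fun [set: borel M] (fun z => (p t z x ^+ 2)%:E).
  apply/measurable_EFinP; apply: measurable_funX; apply: borel_continuous.
  by have [_ sp _] := p_heat; exact/C1_continuous/smooth_fun2_C1/sp.
apply: (@le_trans _ _ (\int[mu]_(z in (geodesic_ball x rad : set (borel M))) (p t z x ^+ 2)%:E)%E).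
  rewrite /volume -integral_cst//; apply: ge0_le_integral => //.
  - by move=> z _; rewrite lee_fin sqr_ge0.
  - exact: measurable_funS mp.
  - by move=> z Bz; rewrite lee_fin lerXn2r ?nnegrE ?hb// (le_trans b0) ?hb.
by apply: ge0_subset_integral => // z _; rewrite lee_fin sqr_ge0.
Qed.

End KernelBound.

(** * The diagonal upper bound *)

Theorem proposition2p1 (R : realType) (n : nat) (M : riemannian_manifold R n)
    (mu : {measure set (borel M) -> \bar R}) (p : R -> M -> M -> R)
    (Mcomplete : complete_manifold M)
    (Mconnected : connected [set: M])
    (Mnoncompact : ~ compact [set: M])
    (mu_riemannian : is_riemannian_measure mu)
    (p_heat : is_heat_kernel mu p)
    (p_gradient : exists C : R, forall (t : R) (x y : M), 0 < t ->
      ((tangent_norm x (gradient (fun z => p t z y) x))%:E <=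
         C%:E / ((Num.sqrt t)%:E * volume mu y (Num.sqrt t)))%E) :
  exists2 C' : R, 0 < C' & forall (t : R) (x : M), 0 < t ->
    ((p t x x)%:E <= C'%:E / volume mu x (Num.sqrt t))%E.
Proof.
have [C hC] := p_gradient.
have C'0 : 0 < 2 * `|C| + 4 by have := normr_ge0 C; lra.
exists (2 * `|C| + 4) => // t x t0; set v := volume mu x (Num.sqrt t).
have [p_gt0 p_smooth _] := p_heat.
have a0 := p_gt0 t x x t0; set a := p t x x in a0 *.
have st : 0 < Num.sqrt t by rewrite sqrtr_gt0.
have C1p := smooth_fun2_C1 (p_smooth t t0) x.
have v0 : (0 <= v)%E by exact: measure_ge0.
(* The gradient bound keeps p_t(., x) close to its value at x on the ball. *)
have hL (L : R) : (forall z, tangent_norm z (gradient (fun y => p t y x) z) <= L) ->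
    forall z, geodesic_ball x (Num.sqrt t) z -> a - L * Num.sqrt t <= p t z x.
  move=> HL z Bz; have := lipschitz_on_ball C1p HL Bz.
  by rewrite ler_distl => /andP[].
have low b : 0 <= b -> (forall z, geodesic_ball x (Num.sqrt t) z -> b <= p t z x) ->
    ((b ^+ 2)%:E * v <= a%:E)%E.
  by move=> b0 hb; exact: (volume_sqr_le mu_riemannian p_heat t0 b0 hb).
have hCx z := hC t z x t0; rewrite -/v in hCx.
case: v v0 hCx low => [v| |] v0 hCx low; last by [].
(* If v = 0 the right-hand side is infinite. *)
- have [->|v_neq0] := eqVneq v 0.
    by rewrite inve0 gt0_muley ?lte_fin// leey.
  have vp : 0 < v by rewrite lt_neqAle eq_sym v_neq0.
  rewrite inver (negbTE v_neq0) -EFinM lee_fin.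
  have aC : forall z, geodesic_ball x (Num.sqrt t) z -> a - C / v <= p t z x.
    have -> : C / v = C / (Num.sqrt t * v) * Num.sqrt t.
      by field; rewrite !gt_eqF.
    apply: hL => z; rewrite -lee_fin; apply: le_trans (hCx z) _.
    by rewrite -EFinM inver mulf_eq0 (gt_eqF st) (negbTE v_neq0) -EFinM.
  rewrite ler_pdivlMr//; have CC := ler_norm C; have C0 := normr_ge0 C.
  have [h|h] := leP (a * v) (2 * C); first by lra.
  (* Otherwise p_t(., x) >= a / 2 on the ball, whence (a / 2)^2 v <= a. *)
  have Cv : C / v <= a / 2 by rewrite ler_pdivrMr//; lra.
  have := low (a / 2) _ _; rewrite divr_ge0 ?(ltW a0)// => /(_ isT).
  rewrite -EFinM lee_fin => low'.
  have : (a / 2) ^+ 2 * v <= a by apply: low' => z /aC; lra.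
  have -> : (a / 2) ^+ 2 * v = a * (a * v / 4) by field.
  by rewrite ger_pMr// ler_pdivrMr// mul1r; lra.
(* If v is infinite, p_t(., x) has no gradient, so it is a > 0 on the whole
   ball, which contradicts its square integrability. *)
- have : ((a ^+ 2)%:E * +oo <= a%:E)%E.
    apply: low => [|z Bz]; first exact: ltW.
    have := hL 0 _ z Bz; rewrite mul0r subr0; apply => w.
    by have := hCx w; rewrite gt0_muley ?lte_fin// invey mule0 lee_fin.
  by rewrite gt0_muley ?lte_fin ?exprn_gt0// leye_eq.
Qed.
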